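(* For every integer $n\ge 3$ there exists an integer $m_n$ such that for every prime power $q\ge m_n$, every maximum Erdős–Ko–Rado set of chambers of $\mathbb{F}_q^{2n}$ is of classical type.
   Context: Let $V$ be a vector space of finite dimension $d$ over $\mathbb{F}_q$. A chamber of $V$ is a set $C=\{C_1,\dots,C_{d-1}\}$ of subspaces with $C_1\subset C_2\subset\cdots\subset C_{d-1}$ and $\dim C_i=i$. Two chambers $C,D$ are opposite if $C_i\cap D_{d-i}=\{0\}$ for all $1\le i\le d-1$. An Erdős–Ko–Rado set (EKR-set) of chambers is a set of chambers no two of which are opposite; it is maximum if it has the largest possible size among all EKR-sets. For $d=2n$, an EKR-set is of classical type if either there is a $1$-dimensional subspace $P$ such that it is the set of all chambers $C$ with $P\le C_n$, or there is a $(2n-1)$-dimensional subspace $H$ such that it is the set of all chambers $C$ with $C_n\le H$. *)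

(* Defs.v *)
From HB Require Import structures.
From mathcomp Require Import all_boot all_order all_algebra.

Set Implicit Arguments.
Unset Strict Implicit.
Unset Printing Implicit Defensive.

(* The subType structure of {vspace V} over matrices is declared there. *)
Import VectorInternalTheory.

HB.instance Definition _ (F : finFieldType) (V : vectType F) :=
  [Countable of {vspace V} by <:].
HB.instance Definition _ (F : finFieldType) (V : vectType F) :=
  [Finite of {vspace V} by <:].

(* A chamber {C_1, ..., C_(d-1)} of F^d is encoded by the tuple listing its
   members in increasing order of dimension; the set and the tuple determine
   each other because dim C_i = i. *)
Definition subspace_tuple (F : finFieldType) (d : nat) : finType :=
  (d.-1).-tuple {vspace 'rV[F]_d}.

(* C_i, with the 1-based index of the text: meaningful for 0 < i < d only. *)
Definition member (F : finFieldType) (d : nat) (C : subspace_tuple F d) (i : nat) :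
    {vspace 'rV[F]_d} :=
  nth 0%VS C i.-1.

Definition chambers (F : finFieldType) (d : nat) : {set subspace_tuple F d} :=
  [set C : subspace_tuple F d |
    sorted (fun U W : {vspace 'rV[F]_d} => (U <= W)%VS) C &&
    [forall i : 'I_d, (0 < i) ==> (\dim (member C i) == i)]].

Definition opposite (F : finFieldType) (d : nat) (C D : subspace_tuple F d) : Prop :=
  forall i : nat, 0 < i < d -> (member C i :&: member D (d - i) = 0)%VS.

(* No C <> D is needed: for 1 < d no chamber is opposite to itself. *)
Definition EKR_set (F : finFieldType) (d : nat) (A : {set subspace_tuple F d}) :
    Prop :=
  A \subset chambers F d /\ {in A &, forall C D, ~ opposite C D}.

Definition maximum_EKR_set (F : finFieldType) (d : nat)
    (A : {set subspace_tuple F d}) : Prop :=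
  EKR_set A /\ forall B : {set subspace_tuple F d}, EKR_set B -> #|B| <= #|A|.

Definition classical_type (F : finFieldType) (n : nat)
    (A : {set subspace_tuple F (2 * n)}) : Prop :=
  (exists P : {vspace 'rV[F]_(2 * n)}, \dim P = 1 /\
     A = [set C in chambers F (2 * n) | (P <= member C n)%VS]) \/
  (exists H : {vspace 'rV[F]_(2 * n)}, \dim H = 2 * n - 1 /\
     A = [set C in chambers F (2 * n) | (member C n <= H)%VS]).

(* Main.v *)
Require Import Defs.
From mathcomp Require Import all_boot all_order all_algebra all_field.
From mathcomp Require Import ring zify.

Set Implicit Arguments.
Unset Strict Implicit.
Unset Printing Implicit Defensive.

Import Order.TTheory GRing.Theory Num.Theory Num.Def.

(** Write [d = 2n] and let [O] be the adjacency matrix of the opposition graph,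
    regular of degree [k].  The functions [C |-> (x \in C_i)] span a space on
    which, apart from the constants, [O^2] acts as [k^2 / q^d].  The rest of the
    eigenspaces of [O^2] for eigenvalues of at least that size is a
    [GL_d]-invariant space without constants.  If it is not zero, the group of
    transvections with a given axis acts on it by some nontrivial character, the
    conjugates of which give dimension at least [(q - 1) q^(d-2)]; for large [q]
    this contradicts the value of the trace of [O^2].  Hence equality in the
    ratio bound forces the characteristic function of a maximum EKR-set [A] to
    be of the form [c + \sum_i \sum_(x in C_i) phi_i x].

    It vanishes on the chambers opposite to a given [C] in [A]; comparing those
    that differ in dimension [i] only, one finds that [phi_i], summed over lines,
    is invariant under translation by [C_(d-i)] outside [C_(d-i)].  The
    eigenvalue equation exchanges [phi_i] and [phi_(d-i)], so the same holds for
    [C_i].  If [A] is not classical, the subspaces [C_i] of its members have zero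
    intersection for [i <= n] and span everything for [i >= n], which makes every
    [phi_i] constant on lines and the characteristic function constant. *)

(** * Linear algebra *)

(** The trace argument has to be exact to first order. With [m] chambers, [s = k / q^n] and the
    eigenvalue of the constants lowered from [k] to [s], the trace of the square is
    [s^2 * (q^d * (m / k - 1) + 1)]. A union bound over the [d - 1] dimensions gives
    [m / k - 1 <= (d - 1) / (q - d)], so there is room for about [(d - 1) q^(d-1)] eigenvalues
    [s^2], with an error of order [q^(d-2)]. The functions of points fill [(d - 1) q^(d-1)] of them
    to first order. The same factor [d - 1] in both estimates leaves a gap of order [q^(d-2)] only,
    which the [(q - 1) q^(d-2)] dimensions of a further invariant space exceed for large [q].
    Squares are taken because opposition exchanges the dimensions [i] and [d - i]. The functions
    [phi_i] are not determined by the set; this is why only their sums over the scalar multiples of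
    a vector are compared. A sum over a chamber sees whole subspaces, so an averaging argument is
    needed to isolate a single line. *)

Section LinearAlgebra.
Local Open Scope ring_scope.
Local Open Scope sesquilinear_scope.

Lemma joint_eigenvector (K : numClosedFieldType) n (E : 'M[K]_n)
    (As : seq 'M[K]_n) :
  E != 0 -> (forall A, A \in As -> (E *m A <= E)%MS) ->
  {in As &, forall A B, comm_mx A B} ->
  exists2 y : 'rV_n, (y != 0) && (y <= E)%MS &
    forall A, A \in As -> exists a, y *m A = a *: y.
Proof.
move=> E0 stE cAs.
have [||v v0 /allP vP] := @common_eigenvector K _ [seq restrictmx E B | B <- As].
- by rewrite lt0n mxrank_eq0.
- move=> _ _ /mapP[B Bin ->] /mapP[B' B'in ->].
  rewrite /comm_mx -?conjmxM ?inE ?stablemx_row_base ?stE //.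
  by rewrite cAs.
exists (v *m row_base E).
  rewrite mulmx_free_eq0 ?row_base_free // v0 /=.
  by rewrite mulmx_sub // eq_row_base.
move=> A Ain.
have /sub_rVP[a Ha] : stablemx (v *m row_base E) A.
  rewrite -stablemx_restrict ?stE //; apply: vP.
  by apply/mapP; exists A.
by exists a.
Qed.

Lemma mxrank_diag_mx01_le (K : fieldType) n (c : pred 'I_n) :
  (\rank (diag_mx (\row_i (c i)%:R : 'rV[K]_n)) <= #|c|)%N.
Proof.
have -> : diag_mx (\row_i (c i)%:R : 'rV[K]_n) = \sum_(i | c i) delta_mx i i.
  apply/matrixP=> i j; rewrite !mxE summxE.
  rewrite (eq_bigr (fun k => ((k == i) && (k == j))%:R)); last first.
    by move=> k _; rewrite !mxE [i == k]eq_sym [j == k]eq_sym.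
  case: (eqVneq i j) => [<-|ij].
    case ci: (c i); last first.
      by rewrite mul0rn big1 // => k ck; case: eqP ci ck => // -> ->.
    rewrite (bigD1 i) //= eqxx big1 ?addr0 // => k /andP[_ /negPf->] //.
  by rewrite mulr0n big1 // => k _; case: eqP => //= ->; rewrite (negPf ij).
rewrite -sum1_card; elim/big_ind2: _ => //; first by rewrite mxrank0.
  by move=> x1 x2 y1 y2 h1 h2; apply: leq_trans (mxrank_add _ _) (leq_add h1 h2).
by move=> i _; rewrite mxrank_delta.
Qed.

Lemma row_sqnorm (C : numClosedFieldType) n (v : 'rV[C]_n) :
  (v *m v^t*) 0 0 = \sum_j `|v 0 j| ^+ 2.
Proof. by rewrite !mxE; apply: eq_bigr => j _; rewrite !mxE normCK. Qed.

Lemma row_sqnorm_ge0 (C : numClosedFieldType) n (v : 'rV[C]_n) :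
  0 <= (v *m v^t*) 0 0.
Proof. by rewrite row_sqnorm sumr_ge0 // => j _; rewrite exprn_ge0. Qed.

Lemma row_sqnorm_eq0 (C : numClosedFieldType) n (v : 'rV[C]_n) :
  ((v *m v^t*) 0 0 == 0) = (v == 0).
Proof. by rewrite -dotmxE dnorm_eq0. Qed.

(** Realness makes [kermx M^T] the Hermitian orthogonal complement of the rows of [M]: a common
    vector [w] satisfies [w *m w^t* = 0]. *)
Lemma real_row_cap_ker (C : numClosedFieldType) r n (M : 'M[C]_(r, n)) :
  M ^ conjC = M -> (M :&: kermx M^T)%MS = 0.
Proof.
move=> Mr; apply/eqP; rewrite -submx0; apply/rV_subP => v.
rewrite sub_capmx => /andP[/submxP[a ->] /sub_kermxP]; set w := a *m M => wM.
suff /eqP-> : w == 0 by rewrite sub0mx.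
rewrite -row_sqnorm_eq0 {2}/w trmx_mul map_mxM mulmxA -map_trmx Mr wM mul0mx.
by rewrite mxE.
Qed.

(* If [T^2] had an eigenvector for an eigenvalue at least [s^2] outside the row
   space of [M], those orthogonal to [M] would span a space of dimension at
   least [delta], which the trace of [T^2] leaves no room for. *)

Lemma unit_gram_rank (K : numClosedFieldType) r m (Y : 'M[K]_(r, m)) (c : K) :
  c != 0 -> Y *m Y^t* = c%:M -> \rank Y = r.
Proof.
move=> c0 YY; apply/eqP; rewrite eqn_leq rank_leq_row /=.
have e : \rank (Y *m Y^t*) = r.
  by rewrite YY mxrank_unit // unitmxE det_scalar unitfE expf_neq0.
by rewrite -[X in (X <= _)%N]e mxrankM_maxl.
Qed.

End LinearAlgebra.

(** * Real symmetric matrices: eigenvectors from a ratio bound and a trace *)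

Section EigenvalueGap.
Local Open Scope ring_scope.
Local Open Scope sesquilinear_scope.
Variables (C : numClosedFieldType) (m r delta : nat).
Variables (T : 'M[C]_m) (M : 'M[C]_(r, m)) (s : C).
Hypotheses (T_sym : T^T = T) (T_real : T ^ conjC = T) (M_real : M ^ conjC = M).
Hypotheses (s_gt0 : 0 < s) (M_eig : M *m T *m T = s ^+ 2 *: M).
Hypothesis rank_big : forall E : 'M[C]_m, E != 0 -> E *m M^T = 0 ->
  (forall B : 'M[C]_m, B *m T = T *m B -> stablemx (kermx M^T) B ->
     stablemx E B) ->
  (delta <= \rank E)%N.
Hypothesis trace_small : \tr (T *m T) < s ^+ 2 * (\rank M + delta)%:R.

Let S : 'M[C]_m := locked (T *m T).

Let SE : S = T *m T. Proof. by rewrite /S -lock. Qed.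

Let P := spectralmx S.
Let D := spectral_diag S.
(** [E] is spanned by the rows of the orthonormal eigenbasis [P] with eigenvalue at least [s ^+ 2];
    the other rows are zeroed, which keeps [E] square. *)
Let chi : 'rV[C]_m := \row_i ((s ^+ 2 <= D 0 i)%R : bool)%:R.
Let E : 'M[C]_m := diag_mx chi *m P.

Let Tt : T^t* = T. Proof. by rewrite T_sym T_real. Qed.

Let scE a (A : 'M[C]_1) : (a *: A) 0 0 = a * A 0 0. Proof. by rewrite mxE. Qed.

Let addE (A B : 'M[C]_1) : (A + B) 0 0 = A 0 0 + B 0 0. Proof. by rewrite mxE. Qed.

Let row_diag_mul (d : 'rV[C]_m) i : row i (diag_mx d *m P) = d 0 i *: row i P.
Proof. by rewrite row_mul row_diag_mx -scalemxAl -rowE. Qed.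

Let S_herm : S^t* = S.
Proof. by rewrite SE trmx_mul map_mxM !Tt. Qed.

Let P_unit : P \in unitmx. Proof. exact: spectral_unit. Qed.

Let P_inv : invmx P = P^t*.
Proof. by rewrite invmx_unitary // spectral_unitarymx. Qed.

Let S_eq : S = invmx P *m diag_mx D *m P.
Proof. by apply/orthomx_spectralP; apply/normalmxP; rewrite S_herm. Qed.

Let PS : P *m S = diag_mx D *m P.
Proof. by rewrite S_eq !mulmxA mulmxV // mul1mx. Qed.

Let diagD : diag_mx D = P *m S *m invmx P.
Proof. by rewrite PS mulmxK. Qed.

Let rowPS i : row i P *m S = D 0 i *: row i P.
Proof. by rewrite -row_mul PS row_diag_mul. Qed.

Let rowPn i : (row i P *m (row i P)^t*) 0 0 = 1.
Proof.
have /unitarymxP/matrixP/(_ i i) := spectral_unitarymx S.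
rewrite -/P [X in _ = X]mxE eqxx => e; rewrite [RHS](_ : _ = true%:R :> C) // -{}e.
by rewrite !mxE; apply: eq_bigr => j _; rewrite !mxE.
Qed.

Let D_ge0 i : 0 <= D 0 i.
Proof.
have := row_sqnorm_ge0 (row i P *m T).
by rewrite trmx_mul map_mxM Tt mulmxA -[_ *m T *m T]mulmxA -SE rowPS
  -scalemxAl mxE rowPn mulr1.
Qed.

Let rank_E_le : s ^+ 2 * (\rank E)%:R <= \tr S.
Proof.
have -> : \tr S = \sum_i D 0 i.
  rewrite S_eq mxtrace_mulC mulmxA mulmxV // mul1mx mxtrace_diag.
  by apply: eq_bigr.
have s2 : 0 < s ^+ 2 by rewrite exprn_gt0.
have /(le_trans _)-> // : s ^+ 2 * (#|[pred i | (s ^+ 2 <= D 0 i)%R]|)%:R <= \sum_i D 0 i.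
  rewrite -sum1_card natr_sum mulr_sumr.
  rewrite [X in _ <= X](bigID [pred i | (s ^+ 2 <= D 0 i)%R]) /=.
  rewrite -[X in X <= _]addr0 lerD ?sumr_ge0 //.
  by apply: ler_sum => i; rewrite inE mulr1.
rewrite ler_pM2l // ler_nat (leq_trans (mxrankM_maxl _ _)) //.
exact: mxrank_diag_mx01_le.
Qed.

Let diag_chi k (N : 'M[C]_(k, m)) :
  N *m diag_mx D = s ^+ 2 *: N -> N *m diag_mx chi = N.
Proof.
move=> /matrixP H; apply/matrixP=> i j; have := H i j.
rewrite !mul_mx_diag !mxE; case: (eqVneq (N i j) 0) => [->|N0].
  by rewrite !mul0r.
by rewrite mulrC => /(mulIf N0)->; rewrite lexx mulr1.
Qed.

Let M_le_E : (M <= E)%MS.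
Proof.
have e : M *m invmx P *m diag_mx chi = M *m invmx P.
  apply: diag_chi; rewrite diagD !mulmxA mulmxKV // SE mulmxA.
  by rewrite M_eig -scalemxAl.
by rewrite -[M](mulmxKV P_unit) -{}e -[_ *m P]mulmxA submxMl.
Qed.

(** In the eigenbasis, a matrix commuting with [S] has nonzero entries only between equal
    eigenvalues, so it respects the cutoff [chi]. *)
Let E_stable (B : 'M[C]_m) : B *m T = T *m B -> stablemx E B.
Proof.
move=> BT; have BS : B *m S = S *m B by rewrite SE mulmxA BT -mulmxA BT mulmxA.
pose B' := P *m B *m invmx P.
have B'D : B' *m diag_mx D = diag_mx D *m B'.
  by rewrite diagD /B' !mulmxA !mulmxKV // -[P *m B *m S]mulmxA BS mulmxA.
have eB : diag_mx chi *m B' = diag_mx chi *m B' *m diag_mx chi.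
  move: (B') B'D => N /matrixP H; apply/matrixP=> i j; have := H i j.
  rewrite !mul_mx_diag !mul_diag_mx !mxE.
  case: (eqVneq (N i j) 0) => [->|N0]; first by rewrite !mulr0 mul0r.
  rewrite mulrC => /(mulIf N0)->.
  by case: (_ <= _); rewrite ?mulr1 // !mul0r.
have -> : stablemx E B = (diag_mx chi *m B' *m P <= E)%MS.
  by rewrite /B' /E -!mulmxA mulVmx // mulmx1.
by rewrite eB -[_ *m _ *m P]mulmxA submxMl.
Qed.

Let cap0 : (E :&: kermx M^T)%MS = 0.
Proof.
apply/eqP; apply/negP => /negP N0.
have Zr : (delta <= \rank (E :&: kermx M^T)%MS)%N.
  apply: rank_big => //; first by apply/sub_kermxP; exact: capmxSr.
  move=> B BT stB; rewrite sub_capmx.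
  rewrite (submx_trans (submxMr _ (capmxSl _ _))) ?E_stable //.
  by rewrite (submx_trans (submxMr _ (capmxSr _ _))).
have : (\rank M + \rank (E :&: kermx M^T)%MS <= \rank E)%N.
  rewrite -mxrank_disjoint_sum; last first.
    apply/eqP; rewrite -submx0 -(real_row_cap_ker M_real).
    by rewrite sub_capmx capmxSl (submx_trans (capmxSr _ _)) // capmxSr.
  by apply: mxrankS; rewrite addsmx_sub M_le_E capmxSl.
move=> /(leq_trans (leq_add (leqnn _) Zr)) rE.
have := lt_le_trans trace_small (le_trans _ rank_E_le).
rewrite -SE ltxx => H; suff: false by []; apply: H.
by rewrite ler_pM2l ?exprn_gt0 // ler_nat.
Qed.

(** The complement [kermx M^T] has rank [m - \rank M] and meets [E] in zero, so
    [\rank E <= \rank M], and the inclusion of [M] in [E] is an equality. *)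
Let E_le_M : (E <= M)%MS.
Proof.
have := mxrank_sum_cap E (kermx M^T); rewrite cap0 mxrank0 addn0 mxrank_ker => e.
have := rank_leq_col (E + kermx M^T)%MS; rewrite e mxrank_tr.
have rM := rank_leq_col M.
rewrite -[X in (_ <= X)%N](subnK rM) addnC leq_add2l => rE.
have := mxrank_leqif_eq M_le_E; case=> le_r /esym.
by rewrite eqn_leq le_r rE => /eqmxP->.
Qed.

Let D_eq i : s ^+ 2 <= D 0 i -> D 0 i = s ^+ 2.
Proof.
move=> hi; have : (row i P <= M)%MS.
  apply: submx_trans E_le_M; have -> : row i P = row i E.
    by rewrite row_diag_mul mxE hi scale1r.
  exact: row_sub.
case/submxP => a ea; have := rowPS i.
rewrite {1}ea SE mulmxA -[a *m M *m T]mulmxA -mulmxA M_eig -scalemxAr -ea => e.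
have := congr1 (fun v : 'rV_m => (v *m (row i P)^t*) 0 0) e.
by rewrite /= -!scalemxAl !scE rowPn !mulr1.
Qed.

(** The hypothesis bounds the squared norm of [g *m T + s *: g] by
    [\sum_j (D 0 j - s ^+ 2) * |y 0 j| ^ 2], where [y] holds the coordinates of [g] in the
    eigenbasis. By [D_eq] no eigenvalue exceeds [s ^+ 2], so both sides vanish: [g] is an
    eigenvector, and it lives on the eigenvalue [s ^+ 2], hence in [M]. *)
Lemma eigenvector_of_ratio_bound (g : 'rV[C]_m) : g ^ conjC = g ->
  (g *m T *m g^T) 0 0 <= - s * (g *m g^T) 0 0 ->
  g *m T = - s *: g /\ (g <= M)%MS.
Proof.
move=> g_real g_le.
have gt : g^t* = g^T by rewrite -map_trmx g_real.
have [y ey] : exists y, g = y *m P by exists (g *m invmx P); rewrite mulmxKV.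
have yy : (g *m g^T) 0 0 = \sum_j `|y 0 j| ^+ 2.
  by rewrite -row_sqnorm -gt ey trmx_mul map_mxM -P_inv -mulmxA
   [P *m _]mulmxA mulmxV // mul1mx.
have yS : (g *m S *m g^T) 0 0 = \sum_j D 0 j * `|y 0 j| ^+ 2.
  rewrite -gt ey trmx_mul map_mxM -P_inv -[y *m P *m S]mulmxA PS !mulmxA.
  rewrite -[_ *m P *m invmx P]mulmxA mulmxV // mulmx1 mul_mx_diag !mxE.
  by apply: eq_bigr => j _; rewrite !mxE normCK mulrAC mulrC.
pose h := g *m T + s *: g.
have hh : (h *m h^t*) 0 0 = (g *m S *m g^T) 0 0 + s *+ 2 * (g *m T *m g^T) 0 0
    + s ^+ 2 * (g *m g^T) 0 0.
  have s_real : s^* = s by apply/CrealP; rewrite gtr0_real.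
  have -> : h^t* = T *m g^T + s *: g^T.
    by rewrite /h linearD /= map_mxD trmx_mul map_mxM Tt gt linearZ /= map_mxZ gt
      /= s_real.
  rewrite /h mulmxDl !mulmxDr -!scalemxAl -!scalemxAr !mulmxA.
  rewrite !addE !scE SE !mulmxA.
  ring.
have hle : (h *m h^t*) 0 0 <= \sum_j (D 0 j - s ^+ 2) * `|y 0 j| ^+ 2.
  under eq_bigr do rewrite mulrBl.
  rewrite sumrB -yS -mulr_sumr -yy hh -addrA lerD2l.
  have := ler_wpM2l (ltW s_gt0) g_le.
  rewrite -subr_ge0 => H; rewrite -subr_ge0; move: H.
  set a := (_ *m _ *m _) 0 0; set b := (_ *m _) 0 0 => H.
  rewrite (_ : _ - _ = (s * (- s * b) - s * a) *+ 2); last by ring.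
  by rewrite mulrn_wge0.
have term j : (D 0 j - s ^+ 2) * `|y 0 j| ^+ 2 <= 0.
  rewrite mulr_le0_ge0 ?exprn_ge0 // subr_le0.
  have /orP[|//] := real_leVge (ger0_real (D_ge0 j)) (ger0_real (exprn_ge0 2 (ltW s_gt0))).
    by [].
  by move/D_eq->.
have sum0 : \sum_j (D 0 j - s ^+ 2) * `|y 0 j| ^+ 2 = 0.
  apply/eqP; rewrite eq_le (le_trans (row_sqnorm_ge0 h) hle) andbT.
  by rewrite -oppr_ge0 -sumrN sumr_ge0 // => j _; rewrite oppr_ge0.
split.
  apply/eqP; rewrite -subr_eq0 scaleNr opprK -/h -row_sqnorm_eq0.
  by rewrite eq_le row_sqnorm_ge0 andbT -sum0.
suff ych : y = y *m diag_mx chi.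
  by rewrite ey ych -mulmxA (submx_trans (submxMl _ _)) // E_le_M.
apply/rowP => j; rewrite mul_mx_diag !mxE.
have := sum0; rewrite -[LHS]opprK -sumrN => /eqP; rewrite oppr_eq0 psumr_eq0; last first.
  by move=> i _; rewrite oppr_ge0.
move/allP => /(_ j (mem_index_enum _)) /=; rewrite oppr_eq0 mulf_eq0 subr_eq0.
rewrite expf_eq0 normr_eq0 /= => /orP[/eqP->|/eqP->]; first by rewrite lexx mulr1.
by rewrite mul0r.
Qed.

End EigenvalueGap.

(** * Chambers and opposition *)

Section Chambers.
Local Open Scope ring_scope.
Variables (F : finFieldType) (d : nat).
Notation V := 'rV[F]_d.
Notation tup := (subspace_tuple F d).
Implicit Types (C D : tup) (g : 'M[F]_d) (U W : {vspace V}).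

(* [member] extended by [C_0 = 0] and [C_d = V]. *)
Definition step C i : {vspace V} :=
  if i == 0%N then 0%VS else if (i < d)%N then member C i else fullv.

Arguments step C i%_N.

Lemma step0 C : step C 0 = 0%VS. Proof. by []. Qed.

Lemma stepd C : (0 < d)%N -> step C d = fullv.
Proof. by rewrite /step ltnn; case: d. Qed.

Lemma step_member C i : (0 < i < d)%N -> step C i = member C i.
Proof. by rewrite /step => /andP[]; case: i => // i _ ->. Qed.

Lemma dim_step C i : C \in chambers F d -> (i <= d)%N -> \dim (step C i) = i.
Proof.
rewrite inE /step => /andP[_ /forallP hC] id.
case: eqP => [->|/eqP]; first by rewrite dimv0.
rewrite -lt0n => i0; case: ltnP => [lt_id|].
  by have /implyP/(_ i0)/eqP := hC (Ordinal lt_id).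
by move=> di; rewrite dimvf /dim /= mul1n; apply/eqP; rewrite eqn_leq di id.
Qed.

Lemma step_sub C i j : C \in chambers F d -> (i <= j)%N ->
  (step C i <= step C j)%VS.
Proof.
rewrite inE /step => /andP[sC _] ij.
case: eqP => [_|/eqP i0]; first exact: sub0v.
have j0 : (j == 0)%N = false by lia.
rewrite j0; case: (ltnP j d) => [jd|]; last by rewrite subvf.
rewrite (leq_ltn_trans ij jd).
have sz : size C = d.-1 by rewrite size_tuple.
apply: (sorted_leq_nth _ _ 0%VS sC); rewrite ?inE ?sz; try lia.
- by move=> ? ? ?; apply: subv_trans.
- by move=> ?; apply: subvv.
Qed.

Lemma step_inj C D :
  (forall i, (0 < i < d)%N -> step C i = step D i) -> C = D.
Proof.
move=> H; apply: val_inj; apply: (@eq_from_nth _ 0%VS); first by rewrite !size_tuple.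
move=> i; rewrite size_tuple => id.
have := H i.+1; rewrite !step_member; try lia.
by rewrite /member /=; apply; lia.
Qed.

Definition chamber_of (K : nat -> {vspace V}) : tup := [tuple K i.+1 | i < d.-1].

Lemma step_chamber_of K i : (0 < i < d)%N -> step (chamber_of K) i = K i.
Proof.
move=> id; rewrite step_member // /member /chamber_of /=.
have lt_i : (i.-1 < d.-1)%N by lia.
rewrite (nth_map (Ordinal lt_i)) ?size_enum_ord // nth_enum_ord //.
by rewrite prednK //; case/andP: id.
Qed.

Lemma chamber_of_chambers K :
  (forall i, (0 < i < d)%N -> \dim (K i) = i) ->
  (forall i, (0 < i)%N -> (i.+1 < d)%N -> (K i <= K i.+1)%VS) ->
  chamber_of K \in chambers F d.
Proof.
move=> dK sK; rewrite inE; apply/andP; split; last first.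
  apply/forallP => i; apply/implyP => i0.
  have id : (0 < i < d)%N by rewrite i0 ltn_ord.
  by rewrite -step_member // step_chamber_of // dK.
apply/(sortedP 0%VS) => i; rewrite size_tuple => lt_i.
have h1 : (0 < i.+1 < d)%N by lia.
have h2 : (0 < i.+2 < d)%N by lia.
rewrite -[nth _ _ i]/(member _ i.+1) -[nth _ _ i.+1]/(member _ i.+2).
by rewrite -!step_member // !step_chamber_of // sK; lia.
Qed.

Definition actv g U : {vspace V} := (linfun (mulmxr g) @: U)%VS.

Lemma memv_actv g U x : g \in unitmx -> (x *m g \in actv g U) = (x \in U).
Proof.
move=> gu; apply/idP/idP; last first.
  by move=> xU; apply/memv_imgP; exists x => //; rewrite lfunE.
case/memv_imgP => y yU; rewrite lfunE /= => e.
by rewrite -(mulmxK gu x) e mulmxK.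
Qed.

Lemma memv_actvV g U x : g \in unitmx -> (x \in actv g U) = (x *m invmx g \in U).
Proof. by move=> gu; rewrite -[in LHS](mulmxKV gu x) memv_actv. Qed.

Lemma dim_actv g U : g \in unitmx -> \dim (actv g U) = \dim U.
Proof.
move=> gu; apply: limg_dim_eq; apply/eqP; rewrite -subv0; apply/subvP => x.
rewrite memv_cap memv_ker memv0 lfunE /= => /andP[_ /eqP e].
by rewrite -(mulmxK gu x) e mul0mx.
Qed.

Definition act g C : tup := map_tuple (actv g) C.

Lemma step_act g C i : g \in unitmx -> step (act g C) i = actv g (step C i).
Proof.
move=> gu; rewrite /step; case: eqP => [_|/eqP i0]; first by rewrite /actv limg0.
case: ltnP => id; last first.
  by apply/vspaceP => x; rewrite memv_actvV // !memvf.
rewrite /member /= (nth_map 0%VS) // size_tuple; lia.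
Qed.

Lemma act_chambers g C : g \in unitmx -> C \in chambers F d -> act g C \in chambers F d.
Proof.
move=> gu CC; have dC i : (i <= d)%N -> \dim (step C i) = i by exact: dim_step.
suff -> : act g C = chamber_of (step (act g C)).
  apply: chamber_of_chambers => [i /andP[_ id]|i _ _].
    by rewrite step_act // dim_actv // dC // ltnW.
  by rewrite !step_act // limgS // step_sub.
by apply: step_inj => i id; rewrite step_chamber_of.
Qed.

Lemma act_inj g : g \in unitmx -> injective (act g).
Proof.
move=> gu C D e; apply: step_inj => i id.
apply/vspaceP => x; have := congr1 (fun C => step C i) e.
by rewrite /= !step_act // => /vspaceP/(_ (x *m g)); rewrite !memv_actv.
Qed.

Definition opp C D :=
  [forall i : 'I_d, (0 < i)%N ==> (member C i :&: member D (d - i)%N == 0)%VS].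

Lemma oppP C D : reflect (opposite C D) (opp C D).
Proof.
apply: (iffP forallP) => [H i /andP[i0 id]|H i].
  by have /implyP/(_ i0)/eqP := H (Ordinal id).
by apply/implyP => i0; apply/eqP; apply: H; rewrite i0 ltn_ord.
Qed.

Lemma opp_step C D : reflect
  (forall i, (0 < i < d)%N -> (step C i :&: step D (d - i)%N = 0)%VS) (opp C D).
Proof.
apply: (iffP (oppP C D)) => H i id; have := H i id.
  by rewrite !step_member //; lia.
by rewrite !step_member //; lia.
Qed.

Lemma opp_mem C D i x : opp C D -> (i <= d)%N ->
  x \in step C i -> x \in step D (d - i) -> x = 0.
Proof.
move=> /opp_step H id xC xD; case: (posnP i) => [i0|i0].
  by move: xC; rewrite i0 memv0 => /eqP.
case: (ltngtP i d) id => // [lt_id|ei] _; last first.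
  by move: xD; rewrite ei subnn memv0 => /eqP.
by apply/eqP; rewrite -memv0 -(H i) ?i0 // memv_cap xC.
Qed.

Lemma opp_memI C D :
  (forall i x, (0 < i < d)%N -> x \in step C i -> x \in step D (d - i) -> x = 0) ->
  opp C D.
Proof.
move=> H; apply/opp_step => i id; apply/eqP; rewrite -subv0; apply/subvP => x.
by rewrite memv_cap memv0 => /andP[xC xD]; rewrite (H i x).
Qed.

Lemma opp_sym C D : opp C D = opp D C.
Proof.
suff H A B : opp A B -> opp B A by apply/idP/idP; apply: H.
move=> AB; apply: opp_memI => i x /andP[i0 id] xB xA.
by apply: (opp_mem AB _ xA); rewrite ?leq_subr // subKn // ltnW.
Qed.

Lemma opp_act g C D : g \in unitmx -> opp (act g C) (act g D) = opp C D.
Proof.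
move=> gu; apply/idP/idP => H; apply: opp_memI => i x id xC xD.
  have xg0 : x *m g = 0.
    by apply: (opp_mem (i := i) H); rewrite ?step_act ?memv_actv //; lia.
  by rewrite -(mulmxK gu x) xg0 mul0mx.
move: xC xD; rewrite !step_act // !memv_actvV // => xC xD.
have xg0 : x *m invmx g = 0 by apply: (opp_mem (i := i) H) => //; lia.
by rewrite -(mulmxKV gu x) xg0 mul0mx.
Qed.

End Chambers.

Arguments step {F d} C i%_N.

(** * Transvections, adapted bases and opposite chambers *)

Section OppositeChambers.
Local Open Scope ring_scope.
Variables (F : finFieldType) (d : nat).
Notation V := 'rV[F]_d.
Notation tup := (subspace_tuple F d).
Implicit Types (C D : tup) (g : 'M[F]_d) (U W : {vspace V}).

Lemma functional_exists (n : nat) (W : {vspace 'rV[F]_n}) (x : 'rV[F]_n) :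
  x \notin W ->
  exists2 l : 'cV[F]_n, (forall w, w \in W -> w *m l = 0) & x *m l = 1%:M.
Proof.
move=> xW; pose f := (\1 - projv W)%VF.
have fW (w : 'rV[F]_n) : w \in W -> f w = 0 :> 'rV[F]_n.
  by move=> wW; rewrite add_lfunE opp_lfunE id_lfunE projv_id // subrr.
have fx : f x != 0.
  apply: contra xW; rewrite add_lfunE opp_lfunE id_lfunE subr_eq0 => /eqP->.
  exact: memv_proj.
have [j fxj] : exists j, f x 0 j != 0.
  by apply/existsP; apply: contraNT fx; rewrite negb_exists => /forallP H;
    apply/eqP/rowP => j; rewrite mxE; apply/eqP; have := H j; rewrite negbK.
exists ((f x 0 j)^-1 *: (lin1_mx f *m delta_mx j 0)) => [w wW|].
  by rewrite -scalemxAr mulmxA mul_rV_lin1 /= (fW w wW) mul0mx scaler0.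
rewrite -scalemxAr mulmxA mul_rV_lin1 /= -colE; apply/matrixP => a b.
by rewrite !ord1 !mxE mulVf.
Qed.

Lemma step_new C i : C \in chambers F d -> (i < d)%N ->
  exists2 x, x \in step C i.+1 & x \notin step C i.
Proof.
move=> CC id; apply/subvPn/negP => /dimvS.
by rewrite !dim_step // ?ltnn // ltnW.
Qed.

Lemma step_line C i x : C \in chambers F d -> (i < d)%N ->
  x \in step C i.+1 -> x \notin step C i -> step C i.+1 = (step C i + <[x]>)%VS.
Proof.
move=> CC id xS xN; apply/eqP; rewrite eq_sym eqEdim subv_add step_sub //=.
rewrite -memvE xS /= dim_step //.
rewrite ltnNge -{2}(dim_step CC (ltnW id)); apply: contra xN => le_dim.
have /eqP-> : step C i == (step C i + <[x]>)%VS by rewrite eqEdim addvSl le_dim.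
by rewrite memvE addvSr.
Qed.

(** With [w *m l = 0] this is a transvection whose axis is the kernel of [l]; without that condition
    the same formula gives the conjugating elements in [rank_lower_bound]. *)
Definition transvection (l : 'cV[F]_d) (w : 'rV[F]_d) : 'M[F]_d := 1%:M + l *m w.

Lemma mul_transvection l w (x : V) : x *m transvection l w = x + (x *m l) 0 0 *: w.
Proof.
rewrite mulmxDr mulmx1 mulmxA [x *m l]mx11_scalar mul_scalar_mx.
by rewrite -mx11_scalar.
Qed.

Lemma transvectionM l w w' : w *m l = 0 ->
  transvection l w *m transvection l w' = transvection l (w + w').
Proof.
move=> wl; rewrite /transvection mulmxDl mul1mx mulmxDr mulmx1.
by rewrite -[l *m w *m _]mulmxA [w *m _]mulmxA wl mul0mx mulmx0 addr0 -addrA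
  -mulmxDr [w' + w]addrC.
Qed.

Lemma transvection0 l : transvection l 0 = 1%:M.
Proof. by rewrite /transvection mulmx0 addr0. Qed.

Lemma transvection_unit l w : w *m l = 0 -> transvection l w \in unitmx.
Proof.
move=> wl; have := transvectionM (- w) wl; rewrite subrr transvection0 => /mulmx1_unit.
by case.
Qed.

(** The chamber is carried to [D] one dimension at a time. If [x] and [y] extend the common [C_i],
    the transvection with direction [y - x] maps [x] to [y] and fixes [C_i] pointwise; its
    functional exists because [x] is outside [C_i + <[y - x]>] as soon as [y] is outside
    [C_(i+1)]. *)
Lemma transvection_transitive (T : Type) (P : tup -> T) :
  (forall l w C, C \in chambers F d -> w *m l = 0 -> P (act (transvection l w) C) = P C) ->
  {in chambers F d &, forall C D, P C = P D}.
Proof.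
move=> Pinv C D CC DC.
suff H i : (i <= d)%N -> exists2 C', C' \in chambers F d &
    P C' = P C /\ forall j, (j <= i)%N -> step C' j = step D j.
  have [C' _ [<- e]] := H d (leqnn d).
  by congr P; apply: step_inj => i id; apply: e; lia.
elim: i => [_|i IH id]; first by exists C => //; split => // j; case: j.
have [C' C'C [PC' eC']] := IH (ltnW id).
have [x xS xN] := step_new C'C id.
have [y yS yN] := step_new DC id.
have eS := step_line C'C id xS xN; have eSD := step_line DC id yS yN.
rewrite -(eC' i) // in eSD yN.
case: (boolP (y \in step C' i.+1)) => [yC'|yC'].
  exists C' => //; split => // j; rewrite leq_eqVlt => /orP[/eqP->|]; last exact: eC'.
  by rewrite eSD; apply: step_line.
have xW : x \notin (step C' i + <[y - x]>)%VS.
  apply: contra yC' => /memv_addP[w wW [_ /vlineP[c ->] e]].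
  have c0 : c != 0.
    by apply: contraNneq xN => c0; rewrite e c0 scale0r addr0.
  have -> : y = x + c^-1 *: (x - w).
    have -> : x - w = c *: (y - x) by apply/eqP; rewrite subr_eq addrC; apply/eqP.
    by rewrite scalerA mulVf // scale1r addrC subrK.
  by rewrite memvD // memvZ // memvB // (subvP (step_sub C'C (leqnSn i))).
have [l lW lx] := functional_exists xW.
have wl : (y - x) *m l = 0.
  by apply: lW; apply: (subvP (addvSr _ _)); rewrite memv_line.
have fixW z : z \in step C' i -> z *m transvection l (y - x) = z.
  move=> zW; rewrite mul_transvection lW; last exact: (subvP (addvSl _ _)).
  by rewrite mxE scale0r addr0.
have gu := transvection_unit wl.
have xg : x *m transvection l (y - x) = y.
  by rewrite mul_transvection lx mxE eqxx scale1r addrC subrK.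
have low j : (j <= i)%N -> step (act (transvection l (y - x)) C') j = step C' j.
  move=> ji; apply/eqP; rewrite eq_sym eqEdim step_act // dim_actv // leqnn andbT.
  apply/subvP => z zj; rewrite -(fixW z) ?memv_actv //.
  exact: (subvP (step_sub C'C ji)).
exists (act (transvection l (y - x)) C'); first exact: act_chambers.
split; first by rewrite Pinv.
move=> j; rewrite leq_eqVlt => /orP[/eqP->|ji]; last by rewrite low // eC'.
have CC2 := act_chambers gu C'C.
rewrite eSD -low //; apply: step_line => //.
  by have := memv_actv (step C' i.+1) x gu; rewrite xg xS step_act.
by rewrite low.
Qed.

(* So [C_j] is spanned by the last [j] of the vectors [e_0, .., e_(d-1)]. *)
Definition adapted C (e : nat -> V) := forall k, (k < d)%N ->
  (e k \in step C (d - k)) && (e k \notin step C (d - k.+1)).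

Definition prefix_mx (e : nat -> V) i : 'M[F]_(i, d) := \matrix_(k < i) e k.

Definition prefix_span (e : nat -> V) i : {vspace V} := limg (linfun (mulmxr (prefix_mx e i))).

Lemma prefix_mxE e i (a : 'rV_i) : a *m prefix_mx e i = \sum_k a 0 k *: e k.
Proof. by rewrite mulmx_sum_row; apply: eq_bigr => k _; rewrite rowK. Qed.

Lemma prefix_spanP e i x : reflect (exists a, x = a *m prefix_mx e i) (x \in prefix_span e i).
Proof.
apply: (iffP memv_imgP) => [[a _ ->]|[a ->]]; first by exists a; rewrite lfunE.
by exists a; rewrite ?memvf ?lfunE.
Qed.

Lemma prefix_span_mem e i k : (k < i)%N -> e k \in prefix_span e i.
Proof.
move=> ki; apply/prefix_spanP; exists (delta_mx 0 (Ordinal ki)).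
by rewrite -rowE rowK.
Qed.

Lemma prefix_span_sub e i W : (forall k, (k < i)%N -> e k \in W) -> (prefix_span e i <= W)%VS.
Proof.
move=> H; apply/subvP => x /prefix_spanP[a ->]; rewrite prefix_mxE memv_suml // => k _.
by rewrite memvZ // H.
Qed.

Lemma adapted_exists C : C \in chambers F d -> exists e, adapted C e.
Proof.
move=> CC; pose p k := [pred x | (x \in step C (d - k)) && (x \notin step C (d - k.+1))].
exists (fun k => odflt 0 [pick x | p k x]) => k kd; case: pickP => [x //|/= H].
have [|x xS xN] := @step_new C (d - k.+1) CC; first by lia.
by rewrite subnSK // in xS; have := H x; rewrite xS xN.
Qed.

Section Adapted.
Variables (C : tup) (e : nat -> V).
Hypotheses (CC : C \in chambers F d) (eC : adapted C e).

(** If [k] is the least index with [a 0 k] nonzero, the whole sum and all its other terms lie in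
    [C_(d-k-1)], which would put [e k] there. Besides independence this shows that [prefix_span e i]
    meets [C_(d-i)] in zero. *)
Lemma adapted_free i (a : 'rV_i) : (i <= d)%N ->
  a *m prefix_mx e i \in step C (d - i) -> a = 0.
Proof.
move=> id aS; apply/eqP; apply/negPn/negP => a0.
have [k0 ak0] : exists k, a 0 k != 0.
  by apply/existsP; apply: contraNT a0; rewrite negb_exists => /forallP H;
    apply/eqP/rowP => j; rewrite mxE; apply/eqP; have := H j; rewrite negbK.
case: (@arg_minnP _ k0 (fun k => a 0 k != 0) val ak0) => k ak kmin.
have kd : (k < d)%N by apply: leq_trans (ltn_ord k) id.
have /andP[_ /negP[]] := eC kd.
have -> : e k = (a 0 k)^-1 *: (a *m prefix_mx e i - \sum_(j | j != k) a 0 j *: e j).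
  by rewrite prefix_mxE (bigD1 k) //= addrK scalerA mulVf // scale1r.
rewrite memvZ // memvB //.
  by apply: (subvP (step_sub CC _) _ aS); have := ltn_ord k; lia.
apply: memv_suml => j jk; case: (eqVneq (a 0 j) 0) => [->|aj].
  by rewrite scale0r mem0v.
have /andP[ej _] := eC (leq_trans (ltn_ord j) id).
rewrite memvZ //; apply: (subvP (step_sub CC _) _ ej).
by have := kmin j aj; rewrite leq_eqVlt eq_sym (inj_eq val_inj) (negPf jk) /=; lia.
Qed.

Lemma adapted_inj i : (i <= d)%N -> injective (fun a : 'rV_i => a *m prefix_mx e i).
Proof.
move=> id a b /= /eqP; rewrite -subr_eq0 -mulmxBl => /eqP ab.
by apply/eqP; rewrite -subr_eq0; apply/eqP/(adapted_free id); rewrite ab mem0v.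
Qed.

Lemma dim_prefix_span i : (i <= d)%N -> \dim (prefix_span e i) = i.
Proof.
move=> id; rewrite limg_dim_eq ?dimvf /dim /= ?mul1n //.
apply/eqP; rewrite -subv0; apply/subvP => a.
rewrite memv_cap memv_ker memv0 lfunE /= => /andP[_ /eqP a0].
by apply/eqP/(adapted_free id); rewrite a0 mem0v.
Qed.

Lemma prefix_span_chamber : chamber_of (prefix_span e) \in chambers F d.
Proof.
apply: chamber_of_chambers => [i id|i _ _]; first by rewrite dim_prefix_span //; lia.
by apply: prefix_span_sub => k ki; apply: prefix_span_mem; lia.
Qed.

Lemma prefix_span_opp : opp C (chamber_of (prefix_span e)).
Proof.
rewrite opp_sym; apply: opp_memI => i x id; rewrite step_chamber_of //.
case/prefix_spanP => a -> aC; rewrite (adapted_free _ aC) ?mul0mx //; lia.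
Qed.

End Adapted.

Lemma opp_exists C : C \in chambers F d ->
  exists2 D, D \in chambers F d & opp C D.
Proof.
move=> CC; have [e eC] := adapted_exists CC.
by exists (chamber_of (prefix_span e)); [apply: prefix_span_chamber eC | apply: prefix_span_opp eC].
Qed.

End OppositeChambers.

(** * Invariance of line sums under translations *)

Section Averaging.
Local Open Scope ring_scope.
Variables (F : finFieldType) (d : nat) (K : numFieldType).
Notation V := 'rV[F]_d.
Notation tup := (subspace_tuple F d).
Implicit Types (C D : tup) (W R : {vspace V}).

Lemma sum_line (i : nat) (b : 'rV[F]_i) (G : 'rV[F]_i -> K) : b != 0 ->
  \sum_(a | a \in <[b]>%VS) G a = \sum_(c : F) G (c *: b).
Proof.
move=> b0; rewrite (reindex_onto (fun c : F => c *: b)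
    (fun a => odflt 0 [pick c : F | a == c *: b])) /=; last first.
  move=> a /vlineP[c ->]; case: pickP => [c' /eqP <- //|/(_ c)].
  by rewrite eqxx.
apply: eq_bigl => c; rewrite memvZ ?memv_line //=.
case: pickP => [c'|/(_ c)]; last by rewrite eqxx.
move=> /eqP/eqP; rewrite -subr_eq0 -scalerBl scaler_eq0 (negPf b0) orbF subr_eq0.
by rewrite eq_sym => /eqP->; rewrite eqxx.
Qed.

(* Averaging over all [P] with [b P = 0] makes the terms with [a] not proportional
   to [b] equal on both sides. *)
Lemma averaging (i : nat) (B : 'M[F]_(i, d)) (R : {vspace V}) (b : 'rV[F]_i)
    (l : 'cV[F]_i) (r : V) (phi : V -> K) :
  b *m l = 1%:M -> r \in R ->
  (forall P : 'M[F]_(i, d), (forall k, row k P \in R) ->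
    \sum_a phi (a *m (B + P)) = \sum_a phi (a *m (B + P + l *m r))) ->
  \sum_(c : F) phi (c *: (b *m B)) = \sum_(c : F) phi (c *: (b *m B + r)).
Proof.
move=> bl rR H.
have b0 : b != 0.
  apply/eqP => b0; move: bl; rewrite b0 mul0mx => /matrixP/(_ 0 0).
  by rewrite !mxE => /eqP; rewrite eq_sym oner_eq0.
pose Om := [pred P : 'M[F]_(i, d) | [forall k, row k P \in R] && (b *m P == 0)].
have : \sum_(P in Om) \sum_a phi (a *m (B + P)) =
       \sum_(P in Om) \sum_a phi (a *m (B + P + l *m r)).
  by apply: eq_bigr => P /andP[/forallP PR _]; apply: H.
rewrite exchange_big [in RHS]exchange_big /=.
rewrite (bigID (fun a => a \in <[b]>%VS)) [in RHS](bigID (fun a => a \in <[b]>%VS)) /=.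
rewrite [X in _ + X = _ -> _](eq_bigr (fun a =>
    \sum_(P in Om) phi (a *m (B + P + l *m r)))).
  move/addIr; rewrite !sum_line //.
  have e1 c : \sum_(P in Om) phi (c *: b *m (B + P)) = phi (c *: (b *m B)) *+ #|Om|.
    rewrite -sumr_const; apply: eq_bigr => P /andP[_ /eqP bP].
    by rewrite -scalemxAl mulmxDr bP addr0.
  have e2 c : \sum_(P in Om) phi (c *: b *m (B + P + l *m r)) =
      phi (c *: (b *m B + r)) *+ #|Om|.
    rewrite -sumr_const; apply: eq_bigr => P /andP[_ /eqP bP].
    by rewrite -scalemxAl !mulmxDr bP addr0 mulmxA bl mul1mx.
  rewrite (eq_bigr _ (fun c _ => e1 c)) [in RHS](eq_bigr _ (fun c _ => e2 c)).
  rewrite !sumrMnl -!(mulr_natr (\sum_c _)); apply: mulIf; rewrite pnatr_eq0.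
  have : (0 : 'M[F]_(i, d)) \in Om.
    by rewrite inE mulmx0 eqxx andbT; apply/forallP => k; rewrite row0 mem0v.
  by move=> Om0; apply/eqP => /card0_eq/(_ 0); rewrite Om0.
move=> a /functional_exists[h hb ha].
(* Since [b *m N = 0] and [a *m N = a *m (l *m r)], replacing [P] by [P + N] matches the terms of
   the two sides. *)
pose N := h *m (a *m l) *m r.
have aN : a *m N = a *m (l *m r) by rewrite /N !mulmxA ha mul1mx.
have bN : b *m N = 0 by rewrite /N !mulmxA hb ?memv_line // !mul0mx.
have rN k : row k N \in R.
  rewrite /N row_mul [row k _]mx11_scalar mul_scalar_mx memvZ //.
rewrite (reindex_inj (addIr N)) /=; apply: eq_big => [P|P _].
  rewrite !inE mulmxDr bN addr0; congr andb; apply: eq_forallb => k.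
  rewrite linearD /=; apply/idP/idP => PR; last by rewrite memvD.
  by rewrite -[row k P](addrK (row k N)) memvB.
by rewrite addrA [in LHS]mulmxDr [in RHS]mulmxDr aN.
Qed.

Definition flag_sum (phi : nat -> V -> K) D : K :=
  \sum_(j < d | (0 < j)%N) \sum_(x in step D j) phi j x.

Lemma sum_prefix_span (C : tup) (e : nat -> V) i (phi : V -> K) :
  C \in chambers F d -> adapted C e -> (i <= d)%N ->
  \sum_(x in prefix_span e i) phi x = \sum_a phi (a *m prefix_mx e i).
Proof.
move=> CC eC id; have inj := adapted_inj CC eC id.
rewrite -(big_imset (h := fun a => a *m prefix_mx e i) (fun x => phi x)) /=.
  apply: eq_bigl => x; apply/prefix_spanP/imsetP => [[a ->]|[a _ ->]]; first by exists a.
  by exists a.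
by move=> a b _ _; apply: inj.
Qed.

Definition tweak (e : nat -> V) i (r : V) : nat -> V :=
  fun k => if k == i then e k + r else e k.

Lemma tweak_prefix_span e i c j : j != i.+1 ->
  prefix_span (tweak e i (c *: e i.+1)) j = prefix_span e j.
Proof.
move=> ji; apply/eqP; rewrite eqEsubv; apply/andP; split; apply: prefix_span_sub => k kj.
  rewrite /tweak; case: eqP => [ki|_]; last exact: prefix_span_mem.
  by rewrite memvD ?memvZ ?prefix_span_mem //; subst k; lia.
have := @prefix_span_mem _ _ (tweak e i (c *: e i.+1)) _ _ kj.
rewrite {1}/tweak; case: eqP => [ki|_] // H.
rewrite -[e k](addrK (c *: e i.+1)) memvB // memvZ //.
have /(@prefix_span_mem _ _ (tweak e i (c *: e i.+1))) : (i.+1 < j)%N by subst k; lia.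
by rewrite /tweak; case: eqP => // ?; lia.
Qed.

(* Changing [e_i] to [e_i + r] and putting [e_(i+1) = r] moves the opposite
   chamber [prefix_span e] in dimension [i + 1] only. *)
Lemma adapted_swap C (phi : nat -> V -> K) (k : K) e i :
  C \in chambers F d -> (i.+1 < d)%N -> adapted C e ->
  (forall D, D \in chambers F d -> opp C D -> flag_sum phi D = k) ->
  \sum_a phi i.+1 (a *m prefix_mx e i.+1) =
  \sum_a phi i.+1 (a *m prefix_mx (tweak e i (e i.+1)) i.+1).
Proof.
move=> CC id eC H; set e' := tweak _ _ _.
have eC' : adapted C e'.
  move=> j jd; rewrite /e' /tweak; case: eqP => [->|_]; last exact: eC.
  have /andP[e1 e2] := eC i (ltnW id); have /andP[e3 e4] := eC i.+1 id.
  rewrite memvD // ?(subvP (step_sub CC _) _ e3) //=; last by lia.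
  by apply: contra e2 => e2; rewrite -[e i](addrK (e i.+1)) memvB.
have := H _ (prefix_span_chamber CC eC) (prefix_span_opp CC eC).
rewrite -(H _ (prefix_span_chamber CC eC') (prefix_span_opp CC eC')).
rewrite /flag_sum (bigD1 (Ordinal id)) //= [in RHS](bigD1 (Ordinal id)) //=.
rewrite [X in _ + X = _ -> _](eq_bigr (fun j : 'I_d =>
  \sum_(x in step (chamber_of (prefix_span e')) j) phi j x)).
  move/addIr; rewrite !step_chamber_of ?(sum_prefix_span _ CC) //; lia.
move=> j /andP[j0 jn]; have jd : (0 < j < d)%N by rewrite j0 ltn_ord.
rewrite !step_chamber_of // -[prefix_span e j](@tweak_prefix_span e i 1) ?scale1r //.
Qed.

(** As [r] is outside [C_(d-i-2)], it can be the member [e_(i+1)] of an adapted basis, so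
    [adapted_swap] applies. That lemma compares sums over whole subspaces; perturbing [e_0, .., e_i]
    inside [C_(d-i-1)] keeps the basis adapted and lets [averaging] isolate the line of [v]. *)
Lemma shift_invariance_generic C (phi : nat -> V -> K) (k : K) i v r :
  C \in chambers F d -> (i.+1 < d)%N ->
  (forall D, D \in chambers F d -> opp C D -> flag_sum phi D = k) ->
  v \notin step C (d - i.+1) ->
  r \in step C (d - i.+1) -> r \notin step C (d - i.+2) ->
  \sum_(c : F) phi i.+1 (c *: v) = \sum_(c : F) phi i.+1 (c *: (v + r)).
Proof.
move=> CC id H vN rS rN; have [e0 e0C] := adapted_exists CC.
have [k0 k0i [vk vkN]] : exists2 k0, (k0 <= i)%N &
    v \in step C (d - k0) /\ v \notin step C (d - k0.+1).
  have ex : exists k0, v \notin step C (d - k0.+1) by exists i.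
  case: (ex_minnP ex) => k0 hk0 mk0; exists k0; first exact: mk0.
  split => //; case: k0 hk0 mk0 => [|k0] _ mk0.
    by rewrite subn0 stepd ?memvf //; lia.
  by apply/negPn/negP => /mk0; rewrite ltnn.
(* The basis is chosen so that [v] is [e_i] if [k0 = i] and [e_k0 + e_i] otherwise: its coefficient
   at [e_i], the vector that [tweak] moves, has to be 1. *)
pose e j := if j == i.+1 then r else
            if (j == k0) then (if k0 == i then v else v - e0 i) else e0 j.
have eC : adapted C e.
  move=> j jd; rewrite /e; case: eqP => [->|_]; first by rewrite rS rN.
  case: eqP => [->|_]; last exact: e0C.
  case: eqP => [_|/eqP k0i']; first by rewrite vk vkN.
  have ei : e0 i \in step C (d - k0.+1).
    have /andP[+ _] := e0C i (ltnW id); apply: subvP; apply: step_sub => //; lia.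
  rewrite memvB //; last by apply: (subvP (step_sub CC _) _ ei); lia.
  by apply: contra vkN => h; rewrite -[v](subrK (e0 i)) memvD.
pose b : 'rV[F]_i.+1 := \row_j ((val j == k0) || (val j == i))%:R.
pose l : 'cV[F]_i.+1 := delta_mx ord_max 0.
have bv : b *m prefix_mx e i.+1 = v.
  rewrite prefix_mxE (bigD1 ord_max) //= mxE eqxx orbT scale1r /e.
  have -> : (i == i.+1) = false by lia.
  rewrite [i == k0]eq_sym; case: eqP => [k0e|k0ne].
    rewrite big1 ?addr0 // => j jm; rewrite mxE.
    rewrite k0e orbb (_ : (val j == i) = false) ?scale0r //.
    by apply/negbTE; apply: contra jm => /eqP e1; apply/eqP/val_inj.
  have k0s : (k0 < i.+1)%N by lia.
  rewrite (bigD1 (Ordinal k0s)) /=; last by apply/eqP => /(congr1 val) /=.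
  have k0i1 : (k0 == i.+1) = false by lia.
  rewrite mxE eqxx scale1r k0i1 big1 ?addr0; first by rewrite addrC subrK.
  move=> j /andP[j1 j2]; rewrite mxE (_ : _ || _ = false) ?scale0r //.
  apply/negbTE; rewrite negb_or; apply/andP; split.
    by apply: contra j2 => /eqP e1; apply/eqP/val_inj.
  by apply: contra j1 => /eqP e1; apply/eqP/val_inj.
rewrite -bv; apply: (averaging (R := step C (d - i.+1)) (l := l)) => //.
  apply/matrixP => x y; rewrite !ord1 -colE !mxE /= eqxx orbT //.
move=> P PR.
pose eP j := if insub j is Some jo then e j + row (jo : 'I_i.+1) P else e j.
have bP : prefix_mx eP i.+1 = prefix_mx e i.+1 + P.
  apply/row_matrixP => j; rewrite linearD /= !rowK /eP.
  by rewrite insubT // => jl; congr (_ + row _ _); apply: val_inj.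
have ePi : eP i.+1 = r by rewrite /eP insubF ?ltnn // /e eqxx.
have ePC : adapted C eP.
  move=> j jd; rewrite /eP; case: insubP => [jo jl _|_]; last exact: eC.
  have /andP[e1 e2] := eC j jd; have RS := PR jo.
  have RS2 : row jo P \in step C (d - j.+1).
    by apply: (subvP (step_sub CC _) _ RS); lia.
  rewrite memvD //; last by apply: (subvP (step_sub CC _) _ RS2); lia.
  by apply: contra e2 => h; rewrite -[e j](addrK (row jo P)) memvB.
rewrite -bP (adapted_swap CC id ePC H).
apply: eq_bigr => a _; congr (phi _ (_ *m _)).
apply/row_matrixP => j; rewrite linearD /= !rowK ePi /tweak.
rewrite row_mul /l; case: eqP => [ji|ji].
  congr (_ + _); rewrite (_ : j = ord_max); last exact: val_inj.
  by rewrite rowE mul_delta_mx -rowE; apply/rowP => y; rewrite !mxE.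
rewrite rowE mul_delta_mx_0 ?mul0mx ?addr0 //.
by apply/eqP => e1; apply: ji; rewrite e1.
Qed.

(** If [r] lies in [C_(d-i-1)], any [r1] in [C_(d-i)] outside it makes [r1 - r] generic as well, and
    translating [v] by [r1] or [v + r] by [r1 - r] ends at the same vector. *)
Lemma shift_invariance C (phi : nat -> V -> K) (k : K) i v r :
  C \in chambers F d -> (0 < i < d)%N ->
  (forall D, D \in chambers F d -> opp C D -> flag_sum phi D = k) ->
  v \notin step C (d - i) -> r \in step C (d - i) ->
  \sum_(c : F) phi i (c *: v) = \sum_(c : F) phi i (c *: (v + r)).
Proof.
move=> CC; case: i => // i /= id H vN rS.
case: (boolP (r \in step C (d - i.+2))) => rN; last first.
  exact: (shift_invariance_generic CC id H).
have [|r1 r1S r1N] := @step_new _ _ C (d - i.+2) CC; first by lia.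
rewrite (_ : (d - i.+2).+1 = (d - i.+1)%N) in r1S; last by lia.
have r1r : r1 - r \notin step C (d - i.+2).
  by apply: contra r1N => h; rewrite -[r1](subrK r) memvD.
have r1rS : r1 - r \in step C (d - i.+1) by rewrite memvB.
rewrite (shift_invariance_generic CC id H vN r1S r1N).
have vrN : v + r \notin step C (d - i.+1).
  by apply: contra vN => h; rewrite -[v](addrK r) memvB.
rewrite (shift_invariance_generic CC id H vrN r1rS r1r).
by rewrite -addrA [r + _]addrC subrK.
Qed.

End Averaging.

(** * Counting chambers and opposite chambers *)

Section Counting.
Local Open Scope ring_scope.
Variables (F : finFieldType) (d : nat).
Notation V := 'rV[F]_d.
Notation tup := (subspace_tuple F d).
Notation ch := (chambers F d).
Notation q := #|F|.
Implicit Types (C D : tup) (g : 'M[F]_d) (U W : {vspace V}).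

Lemma actK g : g \in unitmx -> cancel (act g) (act (invmx g)).
Proof.
move=> gu C; have gu' : invmx g \in unitmx by rewrite unitmx_inv.
apply: step_inj => i id; apply/vspaceP => x.
by rewrite !step_act // memv_actvV // invmxK memv_actv.
Qed.

Lemma act_chE g C : g \in unitmx -> (act g C \in ch) = (C \in ch).
Proof.
move=> gu; apply/idP/idP; last exact: act_chambers.
by move/(@act_chambers _ _ (invmx g)); rewrite unitmx_inv actK //; apply.
Qed.

Definition opp_degree C := (\sum_(D in ch | opp C D) 1)%N.

Lemma opp_degree_const : {in ch &, forall C D, opp_degree C = opp_degree D}.
Proof.
apply: transvection_transitive => l w C CC wl; have gu := transvection_unit wl.
rewrite /opp_degree (reindex_inj (act_inj gu)) /=; apply: eq_bigl => D.
by rewrite act_chE // opp_act.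
Qed.

Definition opp_count C i (x : V) := (\sum_(D in ch | opp C D) (x \in step D i))%N.

(** The small and the large members are fixed for different reasons: [l] vanishes on [C_k] for
    [k < j], and [C_k] contains the direction [r] for [k >= j]. *)
Lemma act_stab C j l (r : V) : C \in ch ->
  (forall w, w \in step C j -> w *m l = 0) -> r \in step C j ->
  act (transvection l r) C = C.
Proof.
move=> CC lC rC; have gu := transvection_unit (lC _ rC).
apply: step_inj => k kd; apply/eqP; rewrite step_act // eqEdim dim_actv // leqnn andbT.
apply/subvP => x /memv_imgP[y yC ->]; rewrite lfunE /= mul_transvection.
case: (leqP j k) => jk.
  by rewrite memvD // memvZ // (subvP (step_sub CC jk)).
by rewrite lC ?mxE ?scale0r ?addr0 // (subvP (step_sub CC (ltnW jk))).
Qed.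

Lemma opp_count_shift C i x r : C \in ch -> x \notin step C (d - i) ->
  r \in step C (d - i) -> opp_count C i (x + r) = opp_count C i x.
Proof.
move=> CC xN rC; have [l lC lx] := functional_exists xN.
have gu := transvection_unit (lC _ rC); have gC := act_stab CC lC rC.
rewrite /opp_count (reindex_inj (act_inj gu)) /=; apply: eq_big => D.
  by rewrite act_chE // -{1}gC opp_act.
move=> _; rewrite step_act // (_ : x + r = x *m transvection l r) ?memv_actv //.
by rewrite mul_transvection lx mxE eqxx scale1r.
Qed.

Lemma opp_full C D i : C \in ch -> D \in ch -> opp C D -> (i <= d)%N ->
  (step C (d - i) + step D i)%VS = fullv.
Proof.
move=> CC DC CD id; apply/eqP; rewrite eqEdim subvf /= dimv_disjoint_sum.
  by rewrite !dim_step ?leq_subr // subnK // dimvf /dim /= mul1n.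
apply/eqP; rewrite -subv0; apply/subvP => x; rewrite memv_cap memv0 => /andP[xC xD].
by rewrite (opp_mem CD _ xC) ?leq_subr // subKn.
Qed.

Lemma opp_unique C D i x : C \in ch -> D \in ch -> opp C D -> (i <= d)%N ->
  (\sum_(r in step C (d - i)) ((x + r)%R \in step D i) = 1)%N.
Proof.
move=> CC DC CD id.
have : x \in (step C (d - i) + step D i)%VS by rewrite opp_full // memvf.
case/memv_addP => c cC [y yD xe].
rewrite (bigD1 (- c)) ?memvN //= xe addrAC subrr add0r yD big1 ?addn0 // => r.
case/andP => rC rc; apply/eqP; rewrite eqb0; apply: contra rc => h.
rewrite -addr_eq0 addrC; apply/eqP; apply: (opp_mem CD (leq_subr i d)).
  by rewrite memvD.
rewrite subKn //; have -> : c + r = c + y + r - y by rewrite addrAC addrK.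
by rewrite memvB.
Qed.

(** For [D] opposite to [C], [D_i] meets the coset [x + C_(d-i)] exactly once, the space being the
    direct sum of [D_i] and [C_(d-i)]. If [x] is outside [C_(d-i)], the transvections stabilizing
    [C] make the count the same at all [q ^ (d - i)] points of the coset. *)
Lemma opp_countE C i x : C \in ch -> (i <= d)%N -> x != 0 ->
  (opp_count C i x * q ^ (d - i) = opp_degree C * (x \notin step C (d - i)))%N.
Proof.
move=> CC id x0; case: (boolP (x \in step C (d - i))) => xC; rewrite ?muln0 ?muln1.
  rewrite /opp_count big1 ?mul0n // => D /andP[DC CD]; apply/eqP; rewrite eqb0.
  apply: contra x0 => xD; rewrite (opp_mem CD _ xC) ?leq_subr // subKn //.
have -> : (opp_degree C = \sum_(r in step C (d - i)) opp_count C i (x + r)%R)%N.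
  by rewrite /opp_count exchange_big /=; apply: eq_bigr => D /andP[DC CD]; rewrite opp_unique.
rewrite (eq_bigr (fun=> opp_count C i x)); last by move=> r rC; rewrite opp_count_shift.
by rewrite sum_nat_const mulnC card_vspace dim_step // leq_subr.
Qed.

Definition step_count i (x : V) := (\sum_(D in ch) (x \in step D i))%N.

(** Opposite pairs whose second chamber has [x] in dimension [i] are counted from both ends, and the
    common degree is cancelled. *)
Lemma step_count_rel i x C : C \in ch -> (i <= d)%N -> x != 0 ->
  (step_count i x * q ^ (d - i) + step_count (d - i) x = #|ch|)%N.
Proof.
move=> CC id x0; have deg0 : (0 < opp_degree C)%N.
  have [D DC CD] := opp_exists CC.
  by rewrite /opp_degree (bigD1 D) /= ?DC.
have e : (\sum_(D in ch) opp_count D i x = opp_degree C * step_count i x)%N.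
  rewrite /opp_count (exchange_big_dep (fun D => D \in ch)) /=; last by move=> ? ? _ /andP[].
  rewrite /step_count [RHS]big_distrr /=.
  apply: eq_bigr => D DC; rewrite (opp_degree_const CC DC) /opp_degree big_distrl /=.
  by apply: eq_big => E; rewrite ?mul1n // DC opp_sym.
apply/eqP; rewrite -(eqn_pmul2l deg0) mulnDr mulnA -e big_distrl /=.
rewrite (eq_bigr (fun D => opp_degree C * (x \notin step D (d - i)))%N); last first.
  by move=> D DC; rewrite opp_countE // (opp_degree_const DC CC).
rewrite -big_distrr -mulnDr eqn_pmul2l //= -big_split /= -sum1_card.
by apply/eqP/eq_bigr => D _; case: (_ \in _).
Qed.

(** The relations for [i] and for [d - i] are two linear equations in the two counts; solving them
    replaces a computation with Gaussian binomials. *)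
Lemma step_countE i x C : C \in ch -> (i <= d)%N -> x != 0 ->
  (step_count i x * (q ^ d - 1) = #|ch| * (q ^ i - 1))%N.
Proof.
move=> CC id x0; have h1 := step_count_rel CC id x0.
have := step_count_rel CC (leq_subr i d) x0; rewrite subKn // => h2.
have qi : (0 < q ^ i)%N by rewrite expn_gt0; apply/orP; left; apply/card_gt0P; exists 0.
have qd : (q ^ d = q ^ (d - i) * q ^ i)%N by rewrite -expnD subnK.
rewrite qd; move: h1 h2 qi.
move: (step_count i x) (step_count (d - i)%N x) (q ^ (d - i))%N (q ^ i)%N #|_|.
move=> a b Q P m h1 h2 P0; have : ((a * Q + b) * P = m * P)%N by rewrite h1.
rewrite mulnDl !mulnBr !muln1 mulnA.
have : (m <= m * P)%N by rewrite leq_pmulr.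
lia.
Qed.

Lemma card_line (y : V) : y != 0 ->
  (\sum_(x in <[y]>%VS | x != 0%R) 1 = q.-1)%N.
Proof.
move=> y0; have := card_vspace <[y]>%VS; rewrite dim_vline y0 expn1 => <-.
rewrite (cardD1 0) mem0v add1n /= -sum1_card.
by apply: eq_bigl => x; rewrite !inE andbC.
Qed.

(** A union bound: a chamber [D] not opposite to [C] shares at least [q - 1] nonzero vectors of some
    [C_i] with [D_(d-i)]. For fixed [i] the average number of shared nonzero vectors is
    [(q^i - 1)(q^(d-i) - 1) / (q^d - 1)], which is at most 1. *)
Lemma nonopp_bound C : C \in ch ->
  ((#|ch| - opp_degree C) * (q - 1) <= #|ch| * (d - 1))%N.
Proof.
move=> CC.
have e1 : (#|ch| - opp_degree C = \sum_(D in ch) ~~ opp C D)%N.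
  rewrite -sum1_card (bigID (opp C)) /= addKn.
  by rewrite -big_mkcondr; apply: eq_bigr.
rewrite e1 big_distrl /=.
have step1 D : D \in ch -> (~~ opp C D * (q - 1) <=
   \sum_(i < d | 0 < i) \sum_(x in step C i | x != 0%R) (x \in step D (d - i)))%N.
  move=> DC; case: (boolP (opp C D)) => //= /opp_step nop.
  rewrite mul1n subn1.
  have [i [id [y [yC yD y0]]]] : exists i, (0 < i < d)%N /\
      exists y : V, [/\ y \in step C i, y \in step D (d - i) & y != 0].
    have [/existsP[i /andP[i0 /existsP[y /and3P[h1 h2 h3]]]]|] :=
      boolP [exists i : 'I_d, (0 < i)%N && [exists y : V,
        [&& y \in step C i, y \in step D (d - i) & y != 0]]].
      by exists i; rewrite i0 ltn_ord; split=> //; exists y.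
    rewrite negb_exists => /forallP H; case: nop => i id.
    have /andP[i0 lid] := id.
    apply/eqP; rewrite -subv0; apply/subvP => y; rewrite memv_cap memv0 => /andP[yC yD].
    have := H (Ordinal lid); rewrite /= i0 /= negb_exists => /forallP/(_ y).
    by rewrite yC yD /= negbK.
  have /andP[i0 lid] := id.
  rewrite (bigD1 (Ordinal lid)) //= (leq_trans _ (leq_addr _ _)) //.
  rewrite -(card_line y0) [X in (_ <= X)%N]big_mkcond [X in (X <= _)%N]big_mkcond /=.
  apply: leq_sum => x _; case: ifP => // /andP[/vlineP[c ->] ->].
  by rewrite !memvZ.
apply: (@leq_trans (\sum_(D in ch) \sum_(i < d | (0 < i)%N)
   \sum_(x in step C i | x != 0%R) (x \in step D (d - i)))%N); first exact: leq_sum.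
rewrite exchange_big /=.
have step2 i : (i < d)%N ->
  (\sum_(D in ch) \sum_(x in step C i | x != 0%R) (x \in step D (d - i)) <= #|ch|)%N.
  move=> id; rewrite exchange_big /=.
  have q1 : (1 < q)%N by exact: finRing_gt1.
  have qd : (0 < q ^ d - 1)%N.
    by rewrite subn_gt0 -{1}(expn0 q) ltn_exp2l //; lia.
  rewrite -(leq_pmul2r qd) big_distrl /=.
  rewrite (eq_bigr (fun=> #|ch| * (q ^ (d - i) - 1))%N); last first.
    by move=> x /andP[_ x0]; rewrite -(@step_countE _ x C CC) ?leq_subr.
  have -> : (\sum_(x in step C i | x != 0%R) #|ch| * (q ^ (d - i) - 1) =
     (q ^ i - 1) * (#|ch| * (q ^ (d - i) - 1)))%N.
    rewrite sum_nat_const; congr muln.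
    have := card_vspace (step C i); rewrite dim_step ?(ltnW id) // => <-.
    rewrite [in RHS](cardD1 0) mem0v add1n subn1 /=.
    by apply: eq_card => x; rewrite !inE andbC.
  rewrite mulnCA leq_mul2l; apply/orP; right.
  have eqd : (q ^ d = q ^ (d - i) * q ^ i)%N by rewrite -expnD subnK // ltnW.
  have : (0 < q ^ i)%N by rewrite expn_gt0; lia.
  have : (0 < q ^ (d - i))%N by rewrite expn_gt0; lia.
  rewrite eqd; nia.
apply: leq_trans (_ : \sum_(i < d | 0 < i) #|ch| <= _)%N.
  by apply: leq_sum => i _; apply: step2.
rewrite sum_nat_const mulnC leq_mul2l; apply/orP; right.
rewrite -sum1_card; case: (d) => [|d']; first by rewrite big1 // => -[].
rewrite big_mkcond big_ord_recl /= add0n subn1 /=.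
by rewrite -[X in (_ <= X)%N]card_ord -sum1_card; apply: leq_sum.
Qed.

End Counting.

(** * Invariant spaces of functions on chambers *)

Section ChamberMatrices.
Local Open Scope ring_scope.
Local Open Scope sesquilinear_scope.
Variables (F : finFieldType) (d : nat) (K : numClosedFieldType).
Notation V := 'rV[F]_d.
Notation tup := (subspace_tuple F d).
Notation ch := (chambers F d).
Notation q := #|F|.
Notation m := #|ch|.
Implicit Types (C D : tup) (g : 'M[F]_d) (U W : {vspace V}).

Definition chamber_at (j : 'I_m) : tup := enum_val j.

Lemma chamber_atP j : chamber_at j \in ch. Proof. exact: enum_valP. Qed.

Definition act_idx g (j : 'I_m) : 'I_m := enum_rank_in (chamber_atP j) (act g (chamber_at j)).

Lemma chamber_at_act g j : g \in unitmx -> chamber_at (act_idx g j) = act g (chamber_at j).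
Proof. by move=> gu; rewrite /chamber_at enum_rankK_in // act_chambers // chamber_atP. Qed.

Lemma act_idx_inj g : g \in unitmx -> injective (act_idx g).
Proof.
move=> gu i j e; apply: enum_val_inj; apply: (act_inj gu).
by rewrite -!chamber_at_act // e.
Qed.

Definition act_mx g : 'M[K]_m := \matrix_(i, j) (i == act_idx g j)%:R.

Lemma mul_act_mx r g (A : 'M_(r, m)) i j : (A *m act_mx g) i j = A i (act_idx g j).
Proof.
rewrite mxE (bigD1 (act_idx g j)) //= mxE eqxx mulr1 big1 ?addr0 // => k kj.
by rewrite mxE (negPf kj) mulr0.
Qed.

Lemma actM g h C : g \in unitmx -> h \in unitmx -> act g (act h C) = act (h *m g) C.
Proof.
move=> gu hu; have hgu : h *m g \in unitmx by rewrite unitmx_mul hu.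
apply: step_inj => i id; apply/vspaceP => x; rewrite !step_act //.
by rewrite -[x](mulmxKV hgu) memv_actv // mulmxA !memv_actv.
Qed.

Lemma act_mxM g h : g \in unitmx -> h \in unitmx ->
  act_mx g *m act_mx h = act_mx (h *m g).
Proof.
move=> gu hu; apply/matrixP => i j; rewrite mul_act_mx !mxE; congr (_ == _)%:R.
by apply: enum_val_inj; rewrite -!/(chamber_at _) !chamber_at_act // ?unitmx_mul ?hu // actM.
Qed.

Lemma act_mx_gram g (u v : 'rV[K]_m) : g \in unitmx ->
  (u *m act_mx g) *m (v *m act_mx g)^t* = u *m v^t*.
Proof.
have ct (A : 'rV[K]_m) k : (A^t*) k 0 = (A 0 k)^* by rewrite !mxE.
move=> gu; apply/matrixP => i j; rewrite !ord1 !mxE.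
rewrite [RHS](reindex_inj (act_idx_inj gu)) /=; apply: eq_bigr => k _.
by rewrite !ct !mul_act_mx.
Qed.

Definition opp_mx : 'M[K]_m := \matrix_(i, j) (opp (chamber_at i) (chamber_at j))%:R.

Lemma opp_mx_act g : g \in unitmx -> opp_mx *m act_mx g = act_mx g *m opp_mx.
Proof.
move=> gu; apply/matrixP => i j; rewrite mul_act_mx !mxE chamber_at_act //.
have [k ->] : exists k, i = act_idx g k.
  by exists (invF (act_idx_inj gu) i); rewrite f_invF.
rewrite chamber_at_act // opp_act // (bigD1 k) //= !mxE eqxx mul1r big1 ?addr0 // => l lk.
by rewrite !mxE (inj_eq (act_idx_inj gu)) eq_sym (negPf lk) mul0r.
Qed.

Lemma row_chamber_const (y : 'rV[K]_m) :
  (forall l w, w *m l = 0 -> y *m act_mx (transvection l w) = y) ->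
  forall i j, y 0 i = y 0 j.
Proof.
move=> yfix i j; pose P C : K := \sum_(k | chamber_at k == C) y 0 k.
have PE k : P (chamber_at k) = y 0 k.
  rewrite /P (bigD1 k) //= big1 ?addr0 // => k' /andP[/eqP e /negP[]].
  by apply/eqP/enum_val_inj.
rewrite -!PE; apply: (@transvection_transitive _ _ _ P); rewrite ?chamber_atP //.
move=> l w C CC wl; have [k ->] : exists k, C = chamber_at k.
  by exists (enum_rank_in CC C); rewrite /chamber_at enum_rankK_in.
by rewrite -(chamber_at_act _ (transvection_unit wl)) !PE -[in RHS](yfix l w wl) mul_act_mx.
Qed.

Section RankBound.
Variable E : 'M[K]_m.
Hypotheses (E_neq0 : E != 0).
Hypothesis E_sum0 : forall y : 'rV[K]_m, (y <= E)%MS -> \sum_j y 0 j = 0.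
Hypothesis E_stable : forall g, g \in unitmx -> stablemx E (act_mx g).

(** A vector fixed by all transvections is constant, and the only constant vector with sum zero is
    zero. *)
Lemma moved_vector : exists (y : 'rV[K]_m) (l : 'cV[F]_d) (w : 'rV[F]_d),
  [/\ (y <= E)%MS, w *m l = 0 & y *m act_mx (transvection l w) != y].
Proof.
have [i Ei] : exists i, row i E != 0.
  have : ~~ (E <= (0 : 'M[K]_m))%MS by rewrite submx0.
  by case/row_subPn => i; rewrite submx0; exists i.
have yE := row_sub i E; set y := row i E in Ei yE.
have [H|] := boolP [exists l : 'cV[F]_d, [exists w : 'rV[F]_d,
    (w *m l == 0) && (y *m act_mx (transvection l w) != y)]].
  have /existsP[l /existsP[w /andP[/eqP wl yw]]] := H.
  by exists y, l, w.
rewrite negb_exists => /forallP H; case/negP: Ei.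
have yc : forall j k, y 0 j = y 0 k.
  apply: row_chamber_const => l w wl; have := H l; rewrite negb_exists => /forallP/(_ w).
  by rewrite wl eqxx /= negbK => /eqP.
apply/eqP/rowP => j; rewrite [RHS]mxE; have := E_sum0 yE.
rewrite (eq_bigr (fun=> y 0 j)) // sumr_const card_ord => /eqP.
rewrite mulrn_eq0 => /orP[/eqP m0|/eqP //].
by have := ltn_ord j; rewrite [X in (_ < X)%N]m0.
Qed.

Definition transvection_dir (l : 'cV[F]_d) : pred V := [pred w | w *m l == 0].

Lemma transvection_mxM l w w' : w \in transvection_dir l -> w' \in transvection_dir l ->
  act_mx (transvection l w) *m act_mx (transvection l w') = act_mx (transvection l (w + w')).
Proof.
rewrite !inE => /eqP wl /eqP wl'; rewrite act_mxM ?transvection_unit // transvectionM //.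
by rewrite addrC.
Qed.

Lemma transvection_dirD l w w' : w \in transvection_dir l ->
  (w + w' \in transvection_dir l) = (w' \in transvection_dir l).
Proof. by rewrite !inE mulmxDl => /eqP->; rewrite add0r. Qed.

(** [PR] is a multiple of the projection onto the vectors fixed by the abelian group of
    transvections with functional [l]. If [t] in the group moves [z], then [z *m t - z] is a nonzero
    vector killed by [PR], so the group has a joint eigenvector in that kernel. Its character is
    nontrivial, because otherwise [PR] would multiply it by the order of the group. *)
Lemma character_exists : exists (l : 'cV[F]_d) (y : 'rV[K]_m) (chi : V -> K) v0,
  [/\ (l != 0) && (y != 0), (y <= E)%MS, v0 \in transvection_dir l, chi v0 != 1 &
   forall w, w \in transvection_dir l -> y *m act_mx (transvection l w) = chi w *: y].
Proof.
have [z [l [w0 [zE w0l zw]]]] := moved_vector.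
have w0d : w0 \in transvection_dir l by rewrite inE w0l.
have l0 : l != 0.
  apply: contraNneq zw => ->; rewrite /transvection mul0mx addr0.
  apply/eqP/rowP => j; rewrite mul_act_mx; congr (z _ _).
  apply: enum_val_inj; rewrite -/(chamber_at _) chamber_at_act ?unitmx1 //.
  apply: step_inj => i id; apply/vspaceP => x.
  by rewrite step_act ?unitmx1 // -[x in x \in actv _ _]mulmx1 memv_actv ?unitmx1.
pose PR := \sum_(w in transvection_dir l) act_mx (transvection l w).
have shift w : w \in transvection_dir l -> act_mx (transvection l w) *m PR = PR.
  move=> wd; rewrite /PR mulmx_sumr [RHS](reindex_inj (addrI w)) /=.
  by apply: eq_big => w'; [rewrite transvection_dirD | move=> wd'; rewrite transvection_mxM].
have comm w : w \in transvection_dir l ->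
    PR *m act_mx (transvection l w) = act_mx (transvection l w) *m PR.
  move=> wd; rewrite /PR mulmx_sumr mulmx_suml; apply: eq_bigr => w' wd'.
  by rewrite !transvection_mxM // addrC.
pose E2 := (E :&: kermx PR)%MS.
have z2 : (z *m act_mx (transvection l w0) - z <= E2)%MS.
  rewrite sub_capmx addmx_sub ?eqmx_opp //=.
    by apply/sub_kermxP; rewrite mulmxBl -mulmxA shift // subrr.
  by rewrite (submx_trans (submxMr _ zE)) // E_stable // transvection_unit.
have E20 : E2 != 0.
  by apply: contraNneq zw => E20; move: z2; rewrite E20 submx0 subr_eq0.
have [||y /andP[y0 yE2] yeig] := @joint_eigenvector K m E2
    [seq act_mx (transvection l w) | w <- enum (transvection_dir l)] E20.
- move=> A /mapP[w]; rewrite mem_enum => wd ->; rewrite sub_capmx.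
  have /eqP wl : w *m l == 0 by [].
  rewrite (submx_trans (submxMr _ (capmxSl _ _))) ?E_stable ?transvection_unit //=.
  rewrite (submx_trans (submxMr _ (capmxSr _ _))) //.
  by apply/sub_kermxP; rewrite -mulmxA -comm // mulmxA mulmx_ker mul0mx.
- move=> A B /mapP[w]; rewrite mem_enum => wd -> /mapP[w']; rewrite mem_enum => wd' ->.
  by rewrite /comm_mx !transvection_mxM // addrC.
have [yE /sub_kermxP yPR] : (y <= E)%MS /\ (y <= kermx PR)%MS.
  by apply/andP; rewrite -sub_capmx.
have [j yj] : exists j, y 0 j != 0.
  by apply/existsP; apply: contraNT y0; rewrite negb_exists => /forallP H;
    apply/eqP/rowP => j; rewrite mxE; apply/eqP; have := H j; rewrite negbK.
pose chi w := (y *m act_mx (transvection l w)) 0 j / y 0 j.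
have chiE w : w \in transvection_dir l -> y *m act_mx (transvection l w) = chi w *: y.
  move=> wd; have [|a ya] := yeig (act_mx (transvection l w)).
    by apply: map_f; rewrite mem_enum.
  by rewrite /chi ya mxE mulfK.
have [v0 v0d v01] : exists2 v0, v0 \in transvection_dir l & chi v0 != 1.
  have [H|] := boolP [exists v0 : V, (v0 \in transvection_dir l) && (chi v0 != 1)].
    by have /existsP[v0 /andP[]] := H; exists v0.
  rewrite negb_exists => /forallP H; case/negP: y0.
  move: yPR; rewrite /PR mulmx_sumr (eq_bigr (fun=> y)) => [|w wd]; last first.
    by rewrite chiE //; have := H w; rewrite wd /= negbK => /eqP->; rewrite scale1r.
  rewrite sumr_const -scaler_nat => /eqP.
  rewrite scaler_eq0 pnatr_eq0 => /orP[/eqP /card0_eq/(_ w0)|//].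
  by rewrite w0d.
by exists l, y, chi, v0; rewrite l0.
Qed.

(** [v0] is nonzero and kills [l], which the [i]-th coordinate does not; so the two functionals of
    [b] are independent and all pairs of values are taken equally often. In the application the
    first condition selects one [b] modulo [l], and the second makes [1 + b v0] invertible. *)
Lemma card_slice (l : 'cV[F]_d) (v0 : 'rV[F]_d) i :
  l i 0 != 0 -> v0 *m l = 0 -> v0 != 0 ->
  #|[pred b : 'cV[F]_d | (b i 0 == 0) && ((v0 *m b) 0 0 != -1)]|
   = ((q - 1) * q ^ (d - 2))%N.
Proof.
move=> li v0l v00.
pose S s t := [pred b : 'cV[F]_d | (b i 0 == s) && ((v0 *m b) 0 0 == t)].
have [b2 b2e v0b2] : exists2 b2 : 'cV[F]_d, b2 i 0 = 0 & (v0 *m b2) 0 0 = 1.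
  have vN : v0 \notin <[(delta_mx 0 i)%R : 'rV[F]_d]>%VS.
    apply: contra v00 => /vlineP[c e]; move: v0l; rewrite e -scalemxAl -rowE.
    move=> /matrixP/(_ 0 0); rewrite !mxE => /eqP; rewrite mulf_eq0 (negPf li) orbF.
    by move=> /eqP->; rewrite scale0r.
  have [b bW vb] := functional_exists vN; exists b.
    by have := bW _ (memv_line _); rewrite -rowE => /matrixP/(_ 0 0); rewrite !mxE.
  by rewrite vb mxE eqxx.
have [b1 b1e v0b1] : exists2 b1 : 'cV[F]_d, b1 i 0 = 1 & (v0 *m b1) 0 0 = 0.
  exists ((l i 0)^-1 *: l); first by rewrite mxE mulVf.
  by rewrite -scalemxAr v0l scaler0 mxE.
pose S00 := S 0 0.
have cardS s t : #|S s t| = #|S00|.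
  pose h (b : 'cV[F]_d) := b + (s *: b1 + t *: b2).
  have hinj : injective h by apply: addIr.
  rewrite -(card_image hinj S00); apply: eq_card => b.
  apply/idP/imageP => [|[b' bS ->]].
    move=> /andP[/eqP bs /eqP bt]; exists (b - (s *: b1 + t *: b2)); last by rewrite /h subrK.
    rewrite !inE mulmxBr mulmxDr -!scalemxAr !mxE -!/((_ *m _) 0 0).
    rewrite !mxE in v0b1 v0b2 bt; rewrite v0b1 v0b2 b1e b2e bs bt.
    by rewrite !mulr0 !mulr1 addr0 add0r !subrr eqxx.
  move: bS; rewrite !inE mulmxDr mulmxDr -!scalemxAr !mxE => /andP[/eqP bs /eqP bt].
  rewrite !mxE in v0b1 v0b2 bt; rewrite v0b1 v0b2 b1e b2e bs bt.
  by rewrite !mulr0 !mulr1 addr0 !add0r !eqxx.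
have q0 : (0 < q)%N by apply/card_gt0P; exists 0.
have totq : (q * (q * #|S00|) = q ^ d)%N.
  have -> : (q ^ d = #|{: 'cV[F]_d}|)%N by rewrite card_mx muln1.
  rewrite -[RHS]sum1_card [RHS](partition_big (fun b : 'cV[F]_d => b i 0) predT) //=.
  rewrite -sum_nat_const; apply: eq_bigr => s _.
  rewrite [RHS](partition_big (fun b : 'cV[F]_d => (v0 *m b) 0 0) predT) //=.
  rewrite -sum_nat_const; apply: eq_bigr => t _.
  by rewrite sum1_card -(cardS s t); apply: eq_card => b; rewrite !inE.
have cS0 : #|S00| = (q ^ (d - 2))%N.
  have d2 : (1 < d)%N.
    have s0 : (0 < #|S00|)%N by apply/card_gt0P; exists 0; rewrite !inE mulmx0 !mxE eqxx.
    rewrite -(leq_exp2l _ _ (finRing_gt1 F)) -totq mulnA mulnn leq_pmulr //.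
  apply/eqP; rewrite -(eqn_pmul2l q0) -(eqn_pmul2l q0) totq -!expnS.
  by rewrite -addn2 subnK.
rewrite -cS0.
have -> : (q - 1 = #|predC1 (-1 : F)%R|)%N by rewrite subn1 cardC1.
rewrite -[LHS]sum1_card (partition_big (fun b : 'cV[F]_d => (v0 *m b) 0 0)
  (fun t => t != -1)) /=; last by move=> b /andP[].
rewrite -sum_nat_const; apply: eq_bigr => t tN.
rewrite sum1_card -(cardS 0 t); apply: eq_card => b; rewrite !inE.
rewrite unfold_in /= -andbA; congr andb; rewrite andbC.
by case: eqP => //= ->.
Qed.

(* Conjugation by [1 + b v0] turns [chi] into [w |-> chi w * chi (w b *: v0)], and
   eigenvectors for distinct characters are orthogonal. *)
Lemma rank_lower_bound : ((q - 1) * q ^ (d - 2) <= \rank E)%N.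
Proof.
have [l [y [chi [v0 [/andP[l0 y0] yE v0d chi1 yeig]]]]] := character_exists.
have v0l : v0 *m l = 0 by apply/eqP.
have [i li] : exists i, l i 0 != 0.
  apply/existsP; apply: contraNT l0; rewrite negb_exists => /forallP H.
  by apply/eqP/colP => j; rewrite mxE; apply/eqP; have := H j; rewrite negbK.
have chiD w w' : w \in transvection_dir l -> w' \in transvection_dir l ->
    chi (w + w') = chi w * chi w'.
  move=> wd wd'; have := yeig (w + w'); rewrite transvection_dirD // => /(_ wd').
  rewrite -transvection_mxM // mulmxA yeig // -scalemxAl yeig // scalerA.
  by move=> /eqP; rewrite -subr_eq0 -scalerBl scaler_eq0 (negPf y0) orbF subr_eq0 => /eqP.
have yy0 : (y *m y^t*) 0 0 != 0 by rewrite row_sqnorm_eq0.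
have chi_norm w : w \in transvection_dir l -> chi w * (chi w)^* = 1.
  move=> wd; have wl : w *m l = 0 by apply/eqP.
  have := act_mx_gram y y (transvection_unit wl); rewrite yeig //.
  rewrite linearZ /= map_mxZ /= -scalemxAl -scalemxAr scalerA => /matrixP/(_ 0 0).
  by rewrite [LHS]mxE -[RHS]mul1r => /(mulIf yy0).
have v00 : v0 != 0.
  apply: contraNneq chi1 => v0e; have e : chi v0 * chi v0 = chi v0 * 1.
    by rewrite -chiD // {2}v0e addr0 mulr1.
  apply/eqP/(mulfI _ e); apply/eqP => c0; have := chi_norm v0 v0d.
  by rewrite c0 mul0r => /eqP; rewrite eq_sym oner_eq0.
pose B := [pred b : 'cV[F]_d | (b i 0 == 0) && ((v0 *m b) 0 0 != -1)].
rewrite -(card_slice li v0l v00) -/B.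
have Bunit b : b \in B -> transvection b v0 \in unitmx.
  move=> /andP[_ bv]; set c := (v0 *m b) 0 0 in bv.
  have vb : v0 *m b = c%:M by rewrite [LHS]mx11_scalar.
  have c1 : 1 + c != 0 by rewrite addrC addr_eq0.
  (* The inverse of a rank one perturbation of the identity has the same form, with this factor. *)
  pose a := - (1 + c)^-1.
  have e1 : b *m v0 *m (b *m (a *: v0)) = (a * c) *: (b *m v0).
    by rewrite -mulmxA [v0 *m _]mulmxA vb mul_scalar_mx -!scalemxAr scalerA mulrC.
  have : transvection b v0 *m transvection b (a *: v0) = 1%:M.
    rewrite /transvection mulmxDl mul1mx mulmxDr mulmx1 e1 -scalemxAr -addrA.
    rewrite [X in 1%:M + X](_ : _ = (a + (1 + a * c)) *: (b *m v0)); last first.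
      by rewrite !scalerDl scale1r.
    by rewrite (_ : a + _ = 0) ?scale0r ?addr0 // /a; field.
  by move/mulmx1_unit => [].
pose yb (b : 'cV[F]_d) := y *m act_mx (transvection b v0).
have ybE b w : b \in B -> w \in transvection_dir l ->
    yb b *m act_mx (transvection l w) = (chi w * chi ((w *m b) 0 0 *: v0)) *: yb b.
  move=> bB wd; have wl : w *m l = 0 by apply/eqP.
  have tl : transvection b v0 *m l = l.
    by rewrite /transvection mulmxDl mul1mx -mulmxA v0l mulmx0 addr0.
  have vd : (w *m b) 0 0 *: v0 \in transvection_dir l by rewrite inE -scalemxAl v0l scaler0.
  have wgd : w *m transvection b v0 \in transvection_dir l.
    by rewrite mul_transvection transvection_dirD.
  have wgl : w *m transvection b v0 *m l = 0 by apply/eqP.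
  have e : transvection l w *m transvection b v0 =
      transvection b v0 *m transvection l (w *m transvection b v0).
    by rewrite {1 4}/transvection mulmxDl mul1mx mulmxDr mulmx1
      [transvection b v0 *m (_ *m _)]mulmxA tl mulmxA.
  rewrite /yb -mulmxA act_mxM ?Bunit ?transvection_unit // e -act_mxM ?Bunit ?transvection_unit //.
  by rewrite mulmxA yeig // -scalemxAl mul_transvection chiD.
pose Y : 'M[K]_(#|B|, m) := \matrix_(k < #|B|) yb (enum_val k).
have YE : (Y <= E)%MS.
  apply/row_subP => k; rewrite rowK (submx_trans (submxMr _ yE)) //.
  by rewrite E_stable // Bunit // enum_valP.
apply: leq_trans (mxrankS YE); rewrite (@unit_gram_rank _ _ _ _ _ yy0) //.
apply/matrixP => k k'; rewrite mxE [RHS]mxE.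
have -> : \sum_j Y k j * (Y^t* ) j k' = (yb (enum_val k) *m (yb (enum_val k'))^t* ) 0 0.
  by rewrite mxE; apply: eq_bigr => j _; rewrite !mxE.
case: eqVneq => [<-|kk']; first by rewrite act_mx_gram ?Bunit ?enum_valP.
rewrite mulr0n.
have bB := enum_valP k; have bB' := enum_valP k'.
have : enum_val k != enum_val k' by rewrite (inj_eq enum_val_inj).
move: (enum_val k) (enum_val k') bB bB' => b b' bB bB' bb'.
(* The vector [b - b'] is no multiple of [l], as its [i]-th coordinate is zero. At a direction [w]
   where it takes the value 1, the eigenvalues of [yb b] and [yb b'] differ by the factor
   [chi v0]. *)
have [w wd wbb] : exists2 w : 'rV[F]_d, w \in transvection_dir l & (w *m (b - b')) 0 0 = 1.
  have dN : (b - b')^T \notin <[l^T]>%VS.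
    apply: contra bb' => /vlineP[c e]; have := congr1 (fun A : 'rV_d => A 0 i) e.
    move/andP: bB => [/eqP bi _]; move/andP: bB' => [/eqP bi' _].
    rewrite !mxE bi bi' subrr => /esym/eqP; rewrite mulf_eq0 (negPf li) orbF => /eqP c0.
    rewrite -subr_eq0 -[b - b']trmxK e c0 scale0r trmx0 //.
  have [h hl hd] := functional_exists dN; exists h^T.
    by rewrite inE -[l]trmxK -trmx_mul hl ?memv_line // trmx0.
  by rewrite -[b - b']trmxK -trmx_mul hd mxE mxE.
have wl : w *m l = 0 by apply/eqP.
have := act_mx_gram (yb b) (yb b') (transvection_unit wl); rewrite !ybE //.
rewrite linearZ /= map_mxZ /= -scalemxAl -scalemxAr scalerA => /matrixP/(_ 0 0).
rewrite [LHS]mxE => /eqP; set G := (yb b *m (yb b')^t*) 0 0.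
rewrite -subr_eq0 -{2}[G]mul1r -mulrBl mulf_eq0 => /orP[|/eqP //].
rewrite subr_eq0 => /eqP e; case/negP: chi1.
have vd c : c *: v0 \in transvection_dir l by rewrite inE -scalemxAl v0l scaler0.
move: e; rewrite rmorphM /= mulrACA chi_norm // mul1r.
have -> : (w *m b) 0 0 *: v0 = v0 + (w *m b') 0 0 *: v0.
  by rewrite -{2}[v0]scale1r -scalerDl -wbb mulmxBr !mxE subrK.
rewrite chiD // -mulrA chi_norm // mulr1 => ->//.
Qed.

End RankBound.

End ChamberMatrices.

(** * Functions invariant under translations by a family of subspaces *)

Section Family.
Local Open Scope ring_scope.
Variables (F : finFieldType) (d t : nat) (K : Type) (I : finType) (A : {set I}).
Notation V := 'rV[F]_d.
Variables (R : I -> {vspace V}) (Phi : V -> K).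
Hypothesis dimR : forall i, i \in A -> \dim (R i) = t.
Hypothesis PhiR : forall i v r, i \in A -> v \notin R i -> r \in R i ->
  Phi v = Phi (v + r).

Lemma subv_avoid2 (W U1 U2 : {vspace V}) :
  ~~ (W <= U1)%VS -> ~~ (W <= U2)%VS ->
  exists z, [/\ z \in W, z \notin U1 & z \notin U2].
Proof.
move=> /subvPn[x xW x1] /subvPn[y yW y2].
case: (boolP (x \in U2)) => x2; last by exists x.
case: (boolP (y \in U1)) => y1; last by exists y.
exists (x + y); split; first by rewrite memvD.
  by apply: contra x1 => h; rewrite -[x](addrK y) memvB.
by apply: contra y2 => h; rewrite -[y](addrK x) [y + x]addrC memvB.
Qed.

Let subR i j : i \in A -> j \in A -> (R i <= R j)%VS -> R i = R j.
Proof. by move=> iA jA s; apply/eqP; rewrite eqEdim s !dimR /= ?leqnn. Qed.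

Let pair i j v w : i \in A -> j \in A -> v \in R i -> v \notin R j ->
  w \in R j -> w \notin R i -> Phi v = Phi w.
Proof. by move=> iA jA vi vj wj wi; rewrite (PhiR jA vj wj) addrC -(PhiR iA wi vi). Qed.

Let pair_const i j v w : i \in A -> j \in A -> v \in R i -> v \notin R j ->
  w \in R i -> w \notin R j -> Phi v = Phi w.
Proof.
move=> iA jA vi vj wi wj.
have /subvPn[z zj zi] : ~~ (R j <= R i)%VS.
  by apply: contra vj => /(subR jA iA)->.
by rewrite (pair iA jA vi vj zj zi) (pair iA jA wi wj zj zi).
Qed.

Let base i i' j j' v w : i \in A -> i' \in A -> j \in A -> j' \in A ->
  v \in R i -> v \notin R i' -> w \in R j -> w \notin R j' -> Phi v = Phi w.
Proof.
move=> iA i'A jA j'A vi vi' wj wj'.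
have ni : ~~ (R i <= R i')%VS by apply: contra vi' => /subvP; apply.
have nj : ~~ (R j <= R j')%VS by apply: contra wj' => /subvP; apply.
case: (eqVneq (R i) (R j)) => [e|ne].
  rewrite -e in nj wj; have [z [zi zi' zj']] := subv_avoid2 ni nj.
  by rewrite (pair_const iA i'A vi vi' zi zi') -(pair_const iA j'A wj wj' zi zj').
have nij : ~~ (R i <= R j)%VS by apply: contra ne => /(subR iA jA)->.
have nji : ~~ (R j <= R i)%VS by apply: contra ne => /(subR jA iA)->.
have [z [zi zi' zj]] := subv_avoid2 ni nij.
have [z2 [z2j z2j' z2i]] := subv_avoid2 nj nji.
rewrite (pair_const iA i'A vi vi' zi zi') (pair iA jA zi zj z2j z2i).
by rewrite (pair_const jA j'A z2j z2j' wj wj').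
Qed.

(** A vector of the sum is reduced to one that lies in some [R i] and outside some [R j]: as long as
    it is outside [R i], removing its summand from [R i] does not change [Phi], and the rest is
    still outside [R i]. Equal dimensions ensure that distinct members do not contain each other,
    which lets [base] compare the reduced vectors. *)
Lemma family_const v w :
  v \in (\sum_(i in A) R i)%VS -> w \in (\sum_(i in A) R i)%VS ->
  (exists2 i, i \in A & v \notin R i) -> (exists2 i, i \in A & w \notin R i) ->
  Phi v = Phi w.
Proof.
suff H u : u \in (\sum_(i in A) R i)%VS -> (exists2 i, i \in A & u \notin R i) ->
    exists2 u', Phi u = Phi u' & (exists i j, [/\ i \in A, j \in A, u' \in R i & u' \notin R j]).
  move=> vS wS vN wN.
  have [v' -> [i [i' [iA i'A vi vi']]]] := H v vS vN.
  have [w' -> [j [j' [jA j'A wj wj']]]] := H w wS wN.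
  exact: base vi vi' wj wj'.
case/memv_sumP => f fR ->.
have : forall i, i \in enum A -> i \in A by move=> i; rewrite mem_enum.
rewrite -big_enum /=.
elim: (enum A) => [|i s IH] sA.
  by rewrite big_nil => -[i iA]; rewrite mem0v.
have iA : i \in A by apply: sA; rewrite mem_head.
rewrite big_cons; set S := \sum_(j <- s) f j => -[j jA uN].
case: (boolP (f i + S \in R i)) => ui; first by exists (f i + S) => //; exists i, j.
have e : Phi (f i + S) = Phi S.
  by rewrite (PhiR (r := - f i) iA ui) ?memvN ?fR // addrAC subrr add0r.
have [||u' eu' Hu'] := IH.
- by move=> k ks; apply: sA; rewrite inE ks orbT.
- exists i => //; apply: contra ui => h; rewrite memvD ?fR //.
by exists u' => //; rewrite e.
Qed.

Lemma family_coset v s :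
  v \notin (\sum_(i in A) R i)%VS -> s \in (\sum_(i in A) R i)%VS ->
  Phi v = Phi (v + s).
Proof.
move=> vN /memv_sumP[f fR ->]; rewrite -big_enum /=.
have : forall i, i \in enum A -> i \in A by move=> i; rewrite mem_enum.
elim: (enum A) v vN => [|i l IH] v vN lA; first by rewrite big_nil addr0.
have iA : i \in A by apply: lA; rewrite mem_head.
have fS : f i \in (\sum_(i in A) R i)%VS.
  by apply: (subvP (sumv_sup i iA (subvv _))); apply: fR.
rewrite big_cons addrA -IH.
- apply: (PhiR iA); last exact: fR.
  by apply: contra vN; apply: subvP; apply: sumv_sup (subvv _).
- by apply: contra vN => h; rewrite -[v](addrK (f i)) memvB.
- by move=> k kl; apply: lA; rewrite inE kl orbT.
Qed.

End Family.

(** * Flag sums that are constant on chambers *)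

Section FlagSums.
Local Open Scope ring_scope.
Variables (F : finFieldType) (d : nat) (K : numClosedFieldType).
Notation V := 'rV[F]_d.
Notation tup := (subspace_tuple F d).
Notation ch := (chambers F d).
Notation q := #|F|.
Notation m := #|ch|.
Implicit Types (C D : tup) (g : 'M[F]_d) (U W : {vspace V}).

Lemma chamber_exists : exists C, C \in ch.
Proof.
pose X := vbasis (fullv : {vspace V}).
have szX : size X = d by rewrite size_tuple dimvf /dim /= mul1n.
have fX : free X by apply: basis_free (vbasisP _).
exists (chamber_of (fun i => <<take i X>>%VS)).
apply: chamber_of_chambers => [i id|i _ id].
  have : free (take i X) by move: fX; rewrite -{1}(cat_take_drop i X) => /catl_free.
  by rewrite /free size_take szX => /eqP->; case: ltnP => //; lia.
apply: sub_span => x; rewrite -[i.+1]addn1 takeD mem_cat => -> //.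
Qed.

Lemma step_not_common j (x : V) : (0 < j < d)%N -> x != 0 ->
  exists2 C, C \in ch & x \notin step C j.
Proof.
move=> /andP[j0 jd] x0; have [C0 CC] := chamber_exists.
have [/existsP[C /andP[CC' xC]]|] := boolP [exists C, (C \in ch) && (x \notin step C j)].
  by exists C.
rewrite negb_exists => /forallP H.
have := step_countE CC (ltnW jd) x0; rewrite /step_count (eq_bigr (fun=> 1%N)) ?sum1_card.
  move/eqP; rewrite eqn_pmul2l => [/eqP e|]; last by apply/card_gt0P; exists C0.
  exfalso.
  have q1 : (1 < q)%N by exact: finRing_gt1.
  have := ltn_exp2l j d q1; rewrite jd.
  have : (0 < q ^ j)%N by rewrite expn_gt0; lia.
  lia.
by move=> C CC'; have := H C; rewrite CC' negbK => ->.
Qed.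

Lemma step_through j (x : V) : (0 < j < d)%N ->
  exists2 C, C \in ch & x \in step C j.
Proof.
move=> /andP[j0 jd]; have [C0 CC] := chamber_exists.
case: (eqVneq x 0) => [->|x0]; first by exists C0; rewrite ?mem0v.
have [/existsP[C /andP[CC' xC]]|] := boolP [exists C, (C \in ch) && (x \in step C j)].
  by exists C.
rewrite negb_exists => /forallP H.
have := step_countE CC (ltnW jd) x0; rewrite /step_count big1.
  have mpos : (0 < m)%N by apply/card_gt0P; exists C0.
  have q1 : (1 < q)%N by exact: finRing_gt1.
  have := ltn_exp2l 0 j q1; rewrite j0 expn0 => H1.
  rewrite mul0n => /esym/eqP; rewrite muln_eq0 => e; exfalso; lia.
by move=> C CC'; have := H C; rewrite CC' /= => /negPf->.
Qed.

(** Here every chamber supplies translations. The subspaces [C_(d-i)] together span everything and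
    have no common nonzero vector, so [family_const] reaches all pairs of nonzero vectors. This is
    the independence behind [rank_point_mx]. *)
Lemma flag_sum_injective (phi : nat -> V -> K) c :
  (forall C, C \in ch -> flag_sum phi C = c) ->
  forall i v w, (0 < i < d)%N -> v != 0 -> w != 0 ->
  \sum_(a : F) phi i (a *: v) = \sum_(a : F) phi i (a *: w).
Proof.
move=> H i v w id v0 w0; pose Phi v := \sum_(a : F) phi i (a *: v).
have id' : (0 < d - i < d)%N by lia.
have full u : u \in (\sum_(C in ch) step C (d - i))%VS.
  have [C CC uC] := step_through u id'.
  by apply: (subvP (sumv_sup C CC (subvv _))).
apply: (@family_const F d (d - i) K tup ch (fun C => step C (d - i)) Phi).
- by move=> C CC; rewrite dim_step // leq_subr.
- move=> C x r CC xN rS; apply: (shift_invariance (C := C) (k := c)) => // D DC _; exact: H.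
- exact: full.
- exact: full.
- by have [C] := step_not_common id' v0; exists C.
- by have [C] := step_not_common id' w0; exists C.
Qed.

End FlagSums.

(** * Equality in the ratio bound *)

Section PointMatrix.
Local Open Scope ring_scope.
Local Open Scope sesquilinear_scope.
Variables (F : finFieldType) (d : nat) (K : numClosedFieldType).
Notation V := 'rV[F]_d.
Notation tup := (subspace_tuple F d).
Notation ch := (chambers F d).
Notation q := #|F|.
Notation m := #|ch|.
Implicit Types (C D : tup) (g : 'M[F]_d) (U W : {vspace V}).
Hypothesis d_gt0 : (0 < d)%N.

Let q1 : (1 < q)%N. Proof. exact: finRing_gt1. Qed.

Lemma card_ch_gt0 : (0 < m)%N.
Proof. by have [C CC] := chamber_exists F d; apply/card_gt0P; exists C. Qed.

Lemma sum_chamber_at (G : tup -> K) : \sum_j G (chamber_at j) = \sum_(C in ch) G C.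
Proof. by rewrite [RHS]big_enum_val. Qed.

Definition ones : 'rV[K]_m := const_mx 1.

Definition point_row i (x : V) : 'rV[K]_m := \row_j (x \in step (chamber_at j) i)%:R.

Arguments point_row i%_N x.

Definition point_mx : 'M[K]_(#|{: 'I_d * V}|, m) :=
  \matrix_(p < #|{: 'I_d * V}|) point_row (enum_val p).1 (enum_val p).2.

Lemma point_row_le i x : (i < d)%N -> (point_row i x <= point_mx)%MS.
Proof.
move=> id; have := row_sub (enum_rank (Ordinal id, x)) point_mx.
by rewrite rowK enum_rankK.
Qed.

Lemma point_row0 i : point_row i 0 = ones.
Proof. by apply/rowP => j; rewrite !mxE mem0v. Qed.

Lemma ones_le_point_mx : (ones <= point_mx)%MS.
Proof. by rewrite -(point_row0 0) point_row_le. Qed.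

Lemma point_mx_real : point_mx ^ conjC = point_mx.
Proof. by apply/matrixP => i j; rewrite !mxE; apply/CrealP; rewrite realn. Qed.

Lemma mul_opp_mx (f : 'rV[K]_m) (g : tup -> K) j :
  (forall l, f 0 l = g (chamber_at l)) ->
  (f *m opp_mx F d K) 0 j = \sum_(D in ch | opp (chamber_at j) D) g D.
Proof.
move=> fg; rewrite mxE big_mkcondr /= -sum_chamber_at; apply: eq_bigr => l _.
by rewrite fg !mxE opp_sym; case: (opp _ _); rewrite ?mulr1 ?mulr0.
Qed.

Lemma opp_mx_sym : (opp_mx F d K)^T = opp_mx F d K.
Proof. by apply/matrixP => i j; rewrite !mxE opp_sym. Qed.

Lemma sum_point_ker (y : 'rV[K]_m) : y *m point_mx^T = 0 ->
  forall i x, (i < d)%N -> \sum_j y 0 j * point_row i x 0 j = 0.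
Proof.
move=> ym i x id; have := congr1 (fun f : 'rV_ _ => f 0 (enum_rank (Ordinal id, x))) ym.
rewrite [LHS]mxE [RHS]mxE => e; rewrite -[RHS]e.
by apply: eq_bigr => j _; rewrite !mxE enum_rankK.
Qed.

Lemma point_ker_stable g : g \in unitmx -> stablemx (kermx point_mx^T) (act_mx K g).
Proof.
move=> gu; apply/rV_subP => y' /submxP[w ->]; rewrite mulmxA.
have : w *m kermx point_mx^T *m point_mx^T = 0 by rewrite -mulmxA mulmx_ker mulmx0.
move: (w *m kermx _) => y y0; apply/sub_kermxP/rowP => p; rewrite [RHS]mxE mxE.
rewrite -[RHS](sum_point_ker y0 ((enum_val p).2 *m g) (ltn_ord (enum_val p).1)).
rewrite [RHS](reindex_inj (act_idx_inj gu)) /=; apply: eq_bigr => j _.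
by rewrite mul_act_mx !mxE chamber_at_act // step_act // memv_actv.
Qed.

Definition lines : {set {vspace V}} := [set L | \dim L == 1%N].

Lemma card_lines : (q ^ d - 1 <= #|lines| * (q - 1))%N.
Proof.
have -> : (q ^ d - 1 = \sum_(x : V | x != 0%R) 1)%N.
  rewrite sum1_card subn1; have := cardC1 (0 : V).
  by rewrite card_mx mul1n => <-; apply: eq_card => x; rewrite !inE.
rewrite (partition_big (fun x : V => <[x]>%VS) (fun L => L \in lines)) /=; last first.
  by move=> x x0; rewrite inE dim_vline x0.
rewrite -sum_nat_const; apply: leq_sum => L; rewrite inE => /eqP dL.
have L0 : vpick L != 0 by rewrite vpick0 -dimv_eq0 dL.
rewrite subn1 -(card_line L0) [X in (X <= _)%N]big_mkcond [X in (_ <= X)%N]big_mkcond /=.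
apply: leq_sum => x _; case: ifP => // /andP[x0 /eqP e]; rewrite x0 andbT.
have vL : (<[vpick L]> <= L)%VS by rewrite -memvE memv_pick.
have /eqP-> : <[vpick L]>%VS == L by rewrite eqEdim vL dL dim_vline L0.
by rewrite -e memv_line.
Qed.

(** For each [i] the rows of all nonzero points add up to a constant, so one line [L0] is left out.
    A linear relation among the remaining line functions and [ones] is a constant flag sum; by
    [flag_sum_injective] its coefficients agree on all lines, and on [L0] they are zero. *)
Lemma rank_point_mx : (d.-1 * (#|lines| - 1) + 1 <= \rank point_mx)%N.
Proof.
have [x0 x0n] : exists x : V, x != 0.
  exists (const_mx 1); apply/eqP => /rowP/(_ (Ordinal d_gt0)).
  by rewrite !mxE => /eqP; rewrite oner_eq0.
pose L0 := <[x0]>%VS; have L0L : L0 \in lines by rewrite inE dim_vline x0n.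
pose o0 : 'I_d := Ordinal d_gt0.
(* The extra index [(0, L0)] stands for the constant row. *)
pose S : {set 'I_d * {vspace V}} :=
  (o0, L0) |: setX [set i : 'I_d | (0 < i)%N] (lines :\ L0).
pose row_of (o : 'I_d * {vspace V}) : 'rV[K]_m :=
  if (0 < o.1)%N then \sum_(x : V | (x != 0) && (<[x]>%VS == o.2)) point_row o.1 x else ones.
pose N := \matrix_(p < #|S|) row_of (enum_val p).
have oN : (o0, L0) \notin setX [set i : 'I_d | (0 < i)%N] (lines :\ L0).
  by rewrite in_setX inE.
have cardS : #|S| = (d.-1 * (#|lines| - 1) + 1)%N.
  rewrite cardsU1 oN addnC cardsX; congr (_ * _ + _)%N.
    rewrite -[in RHS](card_ord d) -(cardsC1 o0); apply: eq_card => i.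
    by rewrite !inE -(inj_eq val_inj) /= lt0n.
  by rewrite (cardsD1 L0 lines) L0L add1n subn1.
rewrite -cardS.
have NM : (N <= point_mx)%MS.
  apply/row_subP => p; rewrite rowK /row_of; case: ifP => _; last exact: ones_le_point_mx.
  by apply: summx_sub => x _; rewrite point_row_le.
apply: leq_trans (mxrankS NM).
suff : row_free N by move/eqP->.
rewrite -kermx_eq0; apply/eqP/row_matrixP => p; rewrite row0.
have : row p (kermx N) *m N = 0 by rewrite -row_mul mulmx_ker row0.
move: (row p _) => a aN.
pose co o := \sum_(p | enum_val p == o) a 0 p.
have coE r : co (enum_val r) = a 0 r.
  rewrite /co (bigD1 r) //= big1 ?addr0 // => r' /andP[/eqP e /negP[]].
  by apply/eqP/enum_val_inj.
(* The sum over [i] with [val i == j] has at most one term; it turns an ordinal index into a natural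
   number. *)
pose phi j (x : V) := if (x != 0) && (<[x]>%VS != L0) then
  \sum_(i < d | val i == j) co (i, <[x]>%VS) else 0.
have phiE (i : 'I_d) x : x != 0 -> <[x]>%VS != L0 -> phi i x = co (i, <[x]>%VS).
  move=> xn xL; rewrite /phi xn xL (bigD1 i) //= big1 ?addr0 // => i' /andP[/eqP e /negP[]].
  exact/eqP/val_inj.
have totE C : C \in ch -> flag_sum phi C = - co (o0, L0).
  move=> CC; have := congr1 (fun f : 'rV_m => f 0 (enum_rank_in CC C)) aN.
  have eC : chamber_at (enum_rank_in CC C) = C by rewrite /chamber_at enum_rankK_in.
  rewrite mulmx_sum_row summxE [RHS]mxE.
  rewrite (eq_bigr (fun r => co (enum_val r) * row_of (enum_val r) 0 (enum_rank_in CC C))).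
    rewrite -(big_enum_val (fun o => co o * row_of o 0 (enum_rank_in CC C))) /=.
    rewrite big_setU1 //= {1}/row_of /= mxE mulr1 => /eqP.
    rewrite addrC addr_eq0 => /eqP <-.
    rewrite (eq_bigl (fun o => (o.1 \in [set i : 'I_d | (0 < i)%N]) &&
      (o.2 \in lines :\ L0))); last by case=> i L; rewrite in_setX.
    rewrite -(pair_big (fun i : 'I_d => i \in [set i : 'I_d | (0 < i)%N])
      (fun L => L \in lines :\ L0)
      (fun i L => co (i, L) * row_of (i, L) 0 (enum_rank_in CC C))) /=.
    rewrite /flag_sum; apply: eq_big => [i|i i0]; first by rewrite inE.
    rewrite (bigID (fun x => (x != 0) && (<[x]>%VS != L0))) /= addrC big1 ?add0r; last first.
      by move=> x /andP[_ /negPf xN]; rewrite /phi xN.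
    rewrite (partition_big (fun x : V => <[x]>%VS) (fun L => L \in lines :\ L0)) /=; last first.
      by move=> x /and3P[_ x0' xL]; rewrite !inE xL dim_vline x0'.
    apply: eq_bigr => L; rewrite !inE => /andP[LN _].
    rewrite /row_of /= i0 summxE mulr_sumr big_mkcond [RHS]big_mkcond /=.
    apply: eq_bigr => x _; rewrite mxE eC.
    case: (eqVneq <[x]>%VS L) => [eL|_]; last by rewrite !andbF.
    rewrite -eL in LN *; rewrite !andbT LN !andbT.
    case: (eqVneq x 0) => [|xn] /=; first by rewrite andbF.
    by rewrite andbT phiE //; case: (_ \in _); rewrite ?mulr1 ?mulr0.
  by move=> r _; rewrite coE rowK mxE.
have phi_hom i (a' : F) x : a' != 0 -> phi i (a' *: x) = phi i x.
  move=> an; rewrite /phi scaler_eq0 (negPf an) /=.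
  have -> : <[a' *: x]>%VS = <[x]>%VS; last by [].
  apply/eqP; rewrite eqEdim -memvE memvZ ?memv_line //=.
  by rewrite !dim_vline scaler_eq0 (negPf an) /= leqnn.
have phi_const i v : (0 < i < d)%N -> v != 0 -> phi i v = 0.
  move=> id v0; have sumE x : \sum_(a' : F) phi i (a' *: x) = phi i 0 + (q.-1)%:R * phi i x.
    rewrite (bigD1 0) //= scale0r (eq_bigr (fun=> phi i x)) => [|a' an]; last by rewrite phi_hom.
    rewrite sumr_const -[in LHS](mulr_natl (phi i x)) -(cardC1 (0 : F)).
    by congr (_ + _%:R * _); apply: eq_card.
  have := flag_sum_injective totE id v0 x0n; rewrite !sumE => /addrI/mulfI.
  rewrite pnatr_eq0 => -> //; last by lia.
  by rewrite /phi eqxx andbF.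
have co0 : co (o0, L0) = 0.
  have [C CC] := chamber_exists F d; have := totE C CC; rewrite /flag_sum big1 => [/esym/eqP|i i0].
    by rewrite oppr_eq0 => /eqP.
  rewrite big1 // => x _; case: (eqVneq x 0) => [->|xn]; first by rewrite /phi eqxx.
  by rewrite phi_const // i0 ltn_ord.
apply/rowP => r; rewrite [RHS]mxE -coE; have := enum_valP r.
case: (enum_val r) => i L; rewrite in_setU1 in_setX => /orP[/eqP-> //|].
rewrite !inE /= => /and3P[i0 LN /eqP dL].
have L0' : vpick L != 0 by rewrite vpick0 -dimv_eq0 dL.
have eL : <[vpick L]>%VS = L.
  by apply/eqP; rewrite eqEdim -memvE memv_pick dL dim_vline L0'.
by rewrite -{1}eL -phiE ?eL // phi_const // i0 ltn_ord.
Qed.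

Section Eigenvectors.
Variables n k : nat.
Hypothesis dn : d = (2 * n)%N.
Hypothesis degk : forall C, C \in ch -> opp_degree C = k.

Let qX_neq0 i : (q%:R : K) ^+ i != 0.
Proof. by rewrite expf_neq0 // pnatr_eq0 -lt0n ltnW. Qed.

Lemma degree_gt0 : (0 < k)%N.
Proof.
have [C CC] := chamber_exists F d; rewrite -(degk CC).
by have [D DC CD] := opp_exists CC; rewrite /opp_degree (bigD1 D) /= ?DC.
Qed.

Lemma ones_opp : ones *m opp_mx F d K = k%:R *: ones.
Proof.
apply/rowP => j; rewrite (@mul_opp_mx _ (fun=> 1)) => [|l]; last by rewrite mxE.
rewrite !mxE mulr1 -(degk (chamber_atP j)) /opp_degree natr_sum.
by apply: eq_bigr.
Qed.

Lemma point_row_opp i x : (i <= d)%N -> x != 0 ->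
  point_row i x *m opp_mx F d K = (k%:R / q%:R ^+ (d - i)) *: (ones - point_row (d - i) x).
Proof.
move=> id x0; apply/rowP => j.
rewrite (@mul_opp_mx _ (fun D => (x \in step D i)%:R)) => [|l]; last by rewrite mxE.
have := opp_countE (chamber_atP j) id x0.
rewrite (degk (chamber_atP j)) => /(congr1 (fun a : nat => a%:R : K)).
rewrite !natrM natrX /opp_count natr_sum => /(canRL (mulfK (qX_neq0 _)))->.
by rewrite !mxE; case: (_ \in _); rewrite /= ?subrr ?subr0 ?mulr0 ?mul0r ?mulr1.
Qed.

Lemma point_row_sum i x : (i <= d)%N -> x != 0 ->
  \sum_j point_row i x 0 j = m%:R * (q%:R ^+ i - 1) / (q%:R ^+ d - 1).
Proof.
move=> id x0; have [C CC] := chamber_exists F d.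
have qd : (q%:R ^+ d - 1 : K) != 0.
  rewrite -natrX subr_eq0 -[1]/(1%:R) eqr_nat -[X in _ != X](expn0 q).
  by rewrite eqn_exp2l //; lia.
have := step_countE CC id x0 => /(congr1 (fun a : nat => a%:R : K)).
have qX j : (0 < q ^ j)%N by rewrite expn_gt0; lia.
rewrite !natrM !natrB // !natrX => e; apply: (canRL (mulfK qd)); rewrite -{}e.
congr (_ * _); rewrite /step_count natr_sum -sum_chamber_at.
by apply: eq_bigr => j _; rewrite mxE.
Qed.

Let s : K := k%:R / q%:R ^+ n.

(* The rank one correction lowers the eigenvalue of the constants from [k] to [s],
   so that [shifted_mx ^ 2] acts as [s ^ 2] on all of [point_mx]. *)
Definition shifted_mx : 'M[K]_m :=
  opp_mx F d K - ((k%:R - s) / m%:R) *: const_mx 1.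

Lemma mul_const_mx1 (f : 'rV[K]_m) : f *m const_mx 1 = (\sum_j f 0 j) *: ones.
Proof.
apply/rowP => j; rewrite !mxE mulr1; apply: eq_bigr => l _.
by rewrite mxE mulr1.
Qed.

Lemma mul_shifted (f : 'rV[K]_m) :
  f *m shifted_mx = f *m opp_mx F d K - ((k%:R - s) / m%:R * \sum_j f 0 j) *: ones.
Proof. by rewrite mulmxBr -scalemxAr mul_const_mx1 scalerA. Qed.

Let m_neq0 : (m%:R : K) != 0.
Proof. by rewrite pnatr_eq0 -lt0n card_ch_gt0. Qed.

Lemma ones_shifted : ones *m shifted_mx = s *: ones.
Proof.
rewrite mul_shifted ones_opp (eq_bigr (fun=> 1)) => [|j _]; last by rewrite mxE.
rewrite sumr_const card_ord -scalerBl; congr (_ *: _); by field.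
Qed.

Lemma point_row_shifted i x : (i <= d)%N -> x != 0 ->
  point_row i x *m shifted_mx = (k%:R / q%:R ^+ (d - i)) *: (ones - point_row (d - i) x)
    - ((k%:R - s) * ((q%:R ^+ i - 1) / (q%:R ^+ d - 1))) *: ones.
Proof.
move=> id x0; rewrite mul_shifted point_row_opp // point_row_sum //; congr (_ - _ *: _).
by rewrite -!mulrA mulKf.
Qed.

(** Up to constants, opposition takes the row of [(i, x)] to [- k / q^(d-i)] times the row of
    [(d - i, x)], so two applications multiply by [k^2 / q^d] whatever [i] is. The correction in
    [shifted_mx] is what makes the constants fit. *)
Lemma point_row_eigen i x : (i <= d)%N ->
  point_row i x *m shifted_mx *m shifted_mx = s ^+ 2 *: point_row i x.
Proof.
move=> id; case: (eqVneq x 0) => [->|x0].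
  by rewrite point_row0 ones_shifted -scalemxAl ones_shifted scalerA expr2.
rewrite point_row_shifted // mulmxBl -!scalemxAl mulmxBl ones_shifted.
rewrite point_row_shifted ?leq_subr //.
rewrite subKn //.
have N1 : (q%:R ^+ n + 1 : K) != 0 by rewrite -natrX natr1 pnatr_eq0.
have N2 : (q%:R ^+ n - 1 : K) != 0.
  rewrite -natrX subr_eq0 -[1]/(1%:R) eqr_nat -[X in _ != X](expn0 q).
  by rewrite eqn_exp2l //; lia.
have eqd : q%:R ^+ d = (q%:R ^+ n) ^+ 2 :> K by rewrite -exprM mulnC dn.
have eqdi : q%:R ^+ (d - i) = (q%:R ^+ n) ^+ 2 / q%:R ^+ i :> K.
  by rewrite -eqd; apply: (canRL (mulfK (qX_neq0 _))); rewrite -exprD subnK.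
have N0 := qX_neq0 n; have a0 := qX_neq0 i.
rewrite eqd eqdi /s; move: (q%:R ^+ n) (q%:R ^+ i) N0 N1 N2 a0 => N a N0 N1 N2 a0.
have N3 : N ^+ 2 - 1 != 0 by rewrite subr_sqr_1 mulf_neq0.
apply/rowP => j; rewrite !mxE; move: (_ \in step _ i)%:R => y.
by field; rewrite ?N0 ?a0 ?N3.
Qed.

Lemma point_mx_eigen : point_mx *m shifted_mx *m shifted_mx = s ^+ 2 *: point_mx.
Proof.
apply/row_matrixP => p; rewrite !row_mul rowK linearZ /= rowK.
by rewrite point_row_eigen // ltnW.
Qed.

Lemma shifted_sym : shifted_mx^T = shifted_mx.
Proof. by rewrite linearB /= linearZ /= opp_mx_sym trmx_const. Qed.

Let s_gt0 : 0 < s.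
Proof. by rewrite divr_gt0 ?exprn_gt0 ?ltr0n ?degree_gt0 // ltnW. Qed.

Lemma shifted_real : shifted_mx ^ conjC = shifted_mx.
Proof.
apply/matrixP => i j; rewrite !mxE; apply/CrealP.
by rewrite rpredB ?rpredM ?rpredV ?realn ?rpred1 ?rpredB ?realn // gtr0_real.
Qed.

(** The square of opposition has [k] in every diagonal place, and the correction replaces the
    eigenvalue [k ^ 2] of the constants by [s ^ 2]. *)
Lemma trace_shifted : \tr (shifted_mx *m shifted_mx) = m%:R * k%:R - k%:R ^+ 2 + s ^+ 2.
Proof.
have row1 i : row i (const_mx 1 : 'M[K]_m) = ones by apply/rowP => j; rewrite !mxE.
have tr1 : \tr (const_mx 1 : 'M[K]_m) = m%:R.
  by rewrite /mxtrace (eq_bigr (fun=> 1)) => [|i _]; rewrite ?mxE // sumr_const card_ord.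
have JO : const_mx 1 *m opp_mx F d K = k%:R *: (const_mx 1 : 'M[K]_m).
  by apply/row_matrixP => i; rewrite row_mul row1 ones_opp linearZ /= row1.
have OJ : opp_mx F d K *m const_mx 1 = k%:R *: (const_mx 1 : 'M[K]_m).
  apply: trmx_inj; rewrite trmx_mul opp_mx_sym trmx_const JO linearZ /= trmx_const //.
have JJ : (const_mx 1 : 'M[K]_m) *m const_mx 1 = m%:R *: (const_mx 1 : 'M[K]_m).
  apply/matrixP => i j; rewrite !mxE (eq_bigr (fun=> 1)) => [|l _]; rewrite ?mxE ?mulr1 //.
  by rewrite sumr_const card_ord.
have OO : \tr (opp_mx F d K *m opp_mx F d K) = m%:R * k%:R.
  rewrite /mxtrace (eq_bigr (fun=> k%:R)) => [|i _].
    by rewrite sumr_const card_ord -[LHS]mulr_natl.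
  have := congr1 (fun f : 'rV_m => f 0 i) ones_opp; rewrite !mxE mulr1 => <-.
  apply: eq_bigr => j _; rewrite !mxE mul1r -natrM opp_sym.
  by case: (opp _ _).
rewrite /shifted_mx mulmxBl !mulmxBr -!scalemxAl -!scalemxAr OJ JO JJ !linearB /= !mxtraceZ.
by rewrite OO tr1; field.
Qed.

Lemma shifted_act g : g \in unitmx ->
  act_mx K g *m shifted_mx = shifted_mx *m act_mx K g.
Proof.
move=> gu; rewrite mulmxBr mulmxBl -scalemxAl -scalemxAr opp_mx_act //.
congr (_ - _ *: _); apply/matrixP => i j; rewrite mul_act_mx !mxE.
rewrite (bigD1 (invF (act_idx_inj gu) i)) //= !mxE f_invF eqxx mulr1.
rewrite big1 ?addr0 // => l li; rewrite !mxE mulr1; case: eqP => // e.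
by case/negP: li; rewrite e invF_f.
Qed.

End Eigenvectors.

End PointMatrix.

(* For [m] chambers, degree [k] and [L] points, this says that the trace of
   [shifted_mx ^ 2] is less than [r] times [(k / q ^ n) ^ 2]. *)
Lemma gap_arith (q D e k m r L : nat) :
  2 <= e -> 1 < q -> 0 < k -> k <= m -> 64 * D * D + 4 * D < q ->
  (m - k) * (q - 1) <= m * D ->
  q ^ e.+2 - 1 <= L * (q - 1) ->
  D * (L - 1) + 1 + (q - 1) * q ^ e <= r ->
  m * q ^ e.+2 + k < k * (r + q ^ e.+2).
Proof.
move=> e2 q1 k0 km Dq hm hL hr.
have eQ : q ^ e.+2 = q * q * q ^ e by rewrite !expnS mulnA.
have Q0 : 0 < q ^ e by rewrite expn_gt0; lia.
rewrite eQ in hL *; move: (q ^ e) Q0 hL hr => Q Q0 hL hr {eQ e e2}.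
have [a aq] : exists a, q = a.+1 by exists q.-1; lia.
subst q; rewrite subn1 /= in hm hL hr.
have a0 : 0 < a by lia.
have [x ax] : exists x, a = x + D by exists (a - D); lia.
(* The bound on nonopposite chambers becomes [m / k <= a / x], which reduces the goal to
   [a * W < x * (r' + W)]. *)
have mx : m * x <= k * a by nia.
have Lpos : 0 < L by nia.
have [r' rr] : exists r', r = r'.+1 by exists r.-1; lia.
have [L' LL] : exists L', L = L'.+1 by exists L.-1; lia.
subst r L; rewrite subn1 /= in hr.
set W := a.+1 * a.+1 * Q in hL *.
have ar : D * W + a * a * Q <= a * r' + D * a.+1.
  have h1 : D * W <= D * (L'.+1 * a + 1) by rewrite leq_mul2l; apply/orP; right; lia.
  have h2 : a * (D * L' + a * Q) <= a * r' by rewrite leq_mul2l; apply/orP; right; lia.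
  nia.
have D4 : 4 * D <= a by apply: leq_trans (leq_addl _ _) Dq.
have D2 : 16 * (D * D) < a.
  by move: Dq; rewrite -mulnA; move: (D * D) => t; lia.
have x2 : a <= 2 * x by lia.
have y2 : 2 * (D * a.+1) <= a * a * Q.
  apply: leq_trans (leq_pmulr _ Q0).
  have a1 : D * a.+1 <= D * (2 * a) by rewrite leq_mul2l; apply/orP; right; lia.
  have a2 : 4 * D * a <= a * a by rewrite leq_mul2r D4 orbT.
  lia.
have [y ey] : exists y, a * a * Q = y + D * a.+1 by exists (a * a * Q - D * a.+1); lia.
have yb : a * a * Q <= 2 * y by lia.
(* With [a = x + D] the terms [D * x * W] cancel and this second-order comparison remains. Since [x]
   is at least [a / 2], [y] at least [a^2 Q / 2] and [W] at most [4 a^2 Q], it follows from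
   [16 D^2 < a]. *)
have xy : D * D * W < x * y.
  have h1 : a * (a * a * Q) <= 4 * (x * y).
    by apply: leq_trans (leq_mul x2 yb) _; lia.
  have h2 : a.+1 * a.+1 <= 4 * (a * a).
    have a1 : a.+1 <= 2 * a by lia.
    by apply: leq_trans (leq_mul a1 a1) _; lia.
  have h3 : 4 * (D * D * W) <= 16 * (D * D) * (a * a * Q).
    have -> : 4 * (D * D * W) = 4 * (D * D) * Q * (a.+1 * a.+1) by rewrite /W; ring.
    have -> : 16 * (D * D) * (a * a * Q) = 4 * (D * D) * Q * (4 * (a * a)) by ring.
    by rewrite leq_mul2l h2 orbT.
  have h4 : 16 * (D * D) * (a * a * Q) < a * (a * a * Q).
    by rewrite ltn_mul2r D2 andbT !muln_gt0 a0 Q0.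
  lia.
clearbody W.
have key : a * (a * W) < x * (a * r' + a * W).
  have h1 : x * (D * W + y) <= x * (a * r') by rewrite leq_mul2l; apply/orP; right; lia.
  have h2 : a * (a * W) = x * (a * W) + D * (x * W) + D * D * W by rewrite ax; ring.
  rewrite h2 [in X in _ < X]mulnDr; rewrite mulnDr in h1.
  have : D * (x * W) = x * (D * W) by ring.
  lia.
have key2 : a * W < x * (r' + W) by rewrite -(ltn_pmul2l a0) mulnCA mulnDr.
have key3 : m * x * W < k * (x * (r' + W)).
  apply: (@leq_ltn_trans (k * a * W)); first by rewrite leq_mul2r mx orbT.
  by rewrite -mulnA ltn_pmul2l.
have x0 : 0 < x by lia.
have : m * W < k * (r' + W).
  by rewrite -(ltn_pmul2l x0) mulnA [x * m]mulnC mulnCA.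
nia.
Qed.

(** * Characteristic functions of large EKR-sets as flag sums *)

Section EKRStructure.
Local Open Scope ring_scope.
Local Open Scope sesquilinear_scope.
Variables (F : finFieldType) (d n : nat) (K : numClosedFieldType).
Notation V := 'rV[F]_d.
Notation tup := (subspace_tuple F d).
Notation ch := (chambers F d).
Notation q := #|F|.
Notation m := #|ch|.
Implicit Types (C D : tup) (g : 'M[F]_d) (U W : {vspace V}).
Hypotheses (dn : d = (2 * n)%N) (n_gt1 : (1 < n)%N).
Hypothesis q_big : (64 * d.-1 * d.-1 + 4 * d.-1 < q)%N.

Let d_gt0 : (0 < d)%N. Proof. by lia. Qed.

Lemma degree_exists : exists k, forall C, C \in ch -> opp_degree C = k.
Proof.
have [C0 CC] := chamber_exists F d; exists (opp_degree C0) => C CC'.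
exact: opp_degree_const.
Qed.

Lemma flag_sum_nat (phi : nat -> V -> K) C :
  flag_sum phi C = \sum_(1 <= j < d) \sum_(x in step C j) phi j x.
Proof.
rewrite /flag_sum -(big_mkord (fun j => 0 < j)%N (fun j => \sum_(x in step C j) phi j x)).
rewrite big_ltn_cond /=; last by lia.
rewrite big_nat_cond [RHS]big_nat_cond; apply: eq_bigl => j.
by rewrite andbT; case: j => // j; rewrite andbT.
Qed.

Lemma flag_sum_rev (phi : nat -> V -> K) C :
  flag_sum (fun j => phi (d - j)%N) C =
  \sum_(j < d | (0 < j)%N) \sum_(x in step C (d - j)) phi j x.
Proof.
rewrite flag_sum_nat -(big_mkord (fun j => 0 < j)%N
  (fun j => \sum_(x in step C (d - j)) phi j x)).
rewrite big_nat_rev /= [RHS]big_ltn_cond /=; last by lia.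
rewrite big_nat_cond [RHS]big_nat_cond; apply: eq_big => [j|j /andP[jd _]].
  by rewrite andbT; case: j => // j; rewrite andbT.
by rewrite (_ : (1 + d - j.+1)%N = (d - j)%N) ?subKn //; lia.
Qed.

Lemma onesE j : ones F d K 0 j = 1.
Proof. by rewrite mxE. Qed.

Lemma trace_bound k : (forall C, C \in ch -> opp_degree C = k) ->
  \tr (shifted_mx F d K n k *m shifted_mx F d K n k) <
  (k%:R / q%:R ^+ n) ^+ 2 * (\rank (point_mx F d K) + (q - 1) * q ^ (d - 2))%:R.
Proof.
move=> degk.
have k0 : (0 < k)%N := degree_gt0 degk.
have q1 : (1 < q)%N by exact: finRing_gt1.
rewrite trace_shifted //.
have := rank_point_mx F K d_gt0; move: (\rank _) => r rM.
have cl := card_lines F d.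
have [C CC] := chamber_exists F d; have nb := nonopp_bound CC.
rewrite (degk C CC) [in X in (_ <= X)%N]subn1 in nb.
have km : (k <= m)%N.
  rewrite -(degk C CC) /opp_degree -sum1_card big_mkcondr; apply: leq_sum => D _.
  by case: ifP.
have e2 : (2 <= d - 2)%N by lia.
have ed : (d - 2).+2 = d by lia.
have H : (m * q ^ d + k < k * ((r + (q - 1) * q ^ (d - 2)) + q ^ d))%N.
  have := @gap_arith q d.-1 (d - 2) k m (r + (q - 1) * q ^ (d - 2)) #|lines F d|.
  by rewrite ed; apply => //; rewrite leq_add2r.
move: (r + _)%N H => r' H.
have s2 : (k%:R / q%:R ^+ n) ^+ 2 = k%:R ^+ 2 / (q ^ d)%:R :> K.
  by rewrite expr_div_n natrX -exprM dn mulnC.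
have qd0 : (0 : K) < (q ^ d)%:R by rewrite ltr0n expn_gt0; lia.
have kn : (0 : K) < k%:R by rewrite ltr0n.
rewrite -subr_gt0 s2 -(pmulr_lgt0 _ qd0).
rewrite -(ltr_nat K) -subr_gt0 in H.
have := mulr_gt0 kn H; congr (0 < _).
move: (q ^ d)%N qd0 => Q Q0; have Qn : (Q%:R : K) != 0 by rewrite gt_eqF.
rewrite !(natrD, natrM).
by field.
Qed.

Variable A : {set tup}.
Hypotheses (A_ch : A \subset ch) (A_ekr : {in A &, forall C D, ~~ opp C D}).
Hypothesis A_big : (m <= #|A| * (q ^ n + 1))%N.

(** The second formula is the first one rewritten by the eigenvalue equation: opposition times
    [- s^-1] exchanges the dimensions [i] and [d - i] with the factor [s^-1 * k / q^(d-i)], that is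
    [q^n / q^(d-i)]. Together they give translations by [C_(d-i)] and by [C_i] for the same function
    [phi i]. *)
Lemma ekr_structure : exists (phi : nat -> V -> K) c c', forall C, C \in ch ->
  (C \in A)%:R = c + flag_sum phi C /\
  (C \in A)%:R = c' + flag_sum (fun j x => q%:R ^+ n / q%:R ^+ j * phi (d - j)%N x) C.
Proof.
have [k degk] := degree_exists.
have k0 : (0 < k)%N := degree_gt0 degk.
have m0 : (0 < m)%N := card_ch_gt0 F d.
have q1 : (1 < q)%N by exact: finRing_gt1.
have qX0 i : (q%:R : K) ^+ i != 0 by rewrite expf_neq0 // pnatr_eq0; lia.
have mn0 : (m%:R : K) != 0 by rewrite pnatr_eq0; lia.
have kn0 : (k%:R : K) != 0 by rewrite pnatr_eq0; lia.
pose s : K := k%:R / q%:R ^+ n.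
have s_gt0 : 0 < s by rewrite divr_gt0 ?exprn_gt0 ?ltr0n //; lia.
pose M := point_mx F d K; pose T := shifted_mx F d K n k.
pose mu : K := #|A|%:R / m%:R.
pose f : 'rV[K]_m := \row_j (chamber_at j \in A)%:R.
pose g : 'rV[K]_m := f - mu *: ones F d K.
have sumf : \sum_j f 0 j = #|A|%:R.
  under eq_bigr do rewrite mxE.
  rewrite (sum_chamber_at (fun C => (C \in A)%:R)) -sum1_card natr_sum.
  rewrite big_mkcond [RHS]big_mkcond; apply: eq_bigr => C _.
  case: (boolP (C \in A)) => [CA|_]; first by rewrite (subsetP A_ch).
  by case: ifP.
have sumg : \sum_j g 0 j = 0.
  rewrite (eq_bigr (fun j => f 0 j - mu)) => [|j _]; last by rewrite !mxE mulr1.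
  by rewrite sumrB sumf sumr_const card_ord -(mulr_natr mu) /mu divfK // subrr.
have gT : g *m T = g *m opp_mx F d K by rewrite /T mul_shifted sumg mulr0 scale0r subr0.
have [gs gM] : g *m T = - s *: g /\ (g <= M)%MS.
  apply: (@eigenvector_of_ratio_bound K m _ ((q - 1) * q ^ (d - 2)) T M s) => //.
  - exact: shifted_sym.
  - exact: (shifted_real K n degk).
  - exact: point_mx_real.
  - exact: (point_mx_eigen K d_gt0 dn degk).
  (* The constants are the row of the zero vector, so a vector orthogonal to [point_mx] has sum
     zero. *)
  - move=> E E0 EM Est; apply: rank_lower_bound => // [y /submxP[w ->]|h hu].
      have wE : w *m E *m M^T = 0 by rewrite -mulmxA EM mulmx0.
      rewrite -[RHS](sum_point_ker wE 0 d_gt0).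
      by apply: eq_bigr => j _; rewrite point_row0 onesE mulr1.
    by apply: Est; [exact: shifted_act | exact: point_ker_stable].
  - exact: trace_bound.
  - apply/rowP => j; rewrite !mxE; apply/CrealP.
    by rewrite rpredB ?rpredM ?rpredV ?realn ?rpred1.
  - rewrite gT.
    have fOf : (f *m opp_mx F d K *m f^T) 0 0 = 0.
      rewrite mxE big1 // => j _; rewrite [f^T _ _]mxE [f 0 j]mxE.
      case: (boolP (chamber_at j \in A)) => jA; last by rewrite mulr0.
      rewrite mxE big1 ?mul0r // => l _; rewrite !mxE.
      case: (boolP (chamber_at l \in A)) => lA; last by rewrite mul0r.
      by rewrite (negPf (A_ekr lA jA)) mulr0.
    have onef : (ones F d K *m f^T) 0 0 = #|A|%:R.
      by rewrite -sumf mxE; apply: eq_bigr => j _; rewrite !mxE mul1r.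
    have gone : g *m (ones F d K)^T = 0.
      apply/rowP => j; rewrite !ord1 [RHS]mxE -[RHS]sumg mxE.
      by apply: eq_bigr => l _; rewrite [(ones F d K)^T _ _]mxE onesE mulr1.
    have gt : g^T = f^T - mu *: (ones F d K)^T by rewrite linearB linearZ.
    have gOg : (g *m opp_mx F d K *m g^T) 0 0 = - (mu * k%:R * #|A|%:R).
      have Oone : opp_mx F d K *m (ones F d K)^T = k%:R *: (ones F d K)^T.
        by rewrite -{1}opp_mx_sym -trmx_mul (ones_opp K degk) linearZ.
      rewrite gt mulmxBr -scalemxAr -[g *m _ *m (ones F d K)^T]mulmxA Oone -scalemxAr gone.
      rewrite !scaler0 subr0 /g !mulmxBl mxE fOf add0r -!scalemxAl (ones_opp K degk).
      by rewrite -scalemxAl -onef !mxE mulrA.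
    have gg : (g *m g^T) 0 0 = #|A|%:R - mu * #|A|%:R.
      have subE (P Q : 'M[K]_1) c : (P - c *: Q) 0 0 = P 0 0 - c * Q 0 0 by rewrite !mxE.
      rewrite gt mulmxBr -scalemxAr gone scaler0 subr0 /g mulmxBl -scalemxAl subE onef.
      congr (_ - _); rewrite -sumf mxE; apply: eq_bigr => j _; rewrite !mxE.
      by case: (_ \in _); rewrite ?mulr1 ?mulr0.
    (* The size of [A] enters here: [mu >= 1 / (q^n + 1)], the density at which the ratio bound for
       the eigenvalue [- s] is reached. *)
    have mun : 1 - mu <= q%:R ^+ n * mu.
      rewrite lerBlDr -[X in _ + X]mul1r -mulrDl mulrC /mu mulrAC.
      by rewrite ler_pdivlMr ?ltr0n // mul1r -natrX natr1 -natrM ler_nat -addn1.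
    have smu : s * (1 - mu) <= k%:R * mu.
      apply: le_trans (ler_wpM2l (ltW s_gt0) mun) _.
      by rewrite /s mulrA divfK.
    rewrite gOg gg mulNr lerN2 -{1}[#|A|%:R]mul1r -mulrBl mulrA [mu * _]mulrC.
    by rewrite ler_wpM2r ?ler0n.
have [a ea] := submxP gM.
pose co (i : 'I_d) x := a 0 (enum_rank (i, x)).
pose phi j x := \sum_(i < d | val i == j) co i x.
have phiE (i : 'I_d) x : phi i x = co i x.
  by rewrite /phi (bigD1 i) //= big1 ?addr0 // => i' /andP[/eqP e /negP[]]; exact/eqP/val_inj.
have expand (B : 'M[K]_m) j : (g *m B) 0 j = \sum_i \sum_x co i x * (point_row K i x *m B) 0 j.
  rewrite ea -mulmxA mulmx_sum_row summxE pair_bigA /= (reindex enum_rank) /=; last first.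
    by apply: onW_bij; apply: enum_rank_bij.
  by apply: eq_bigr => -[i x] _; rewrite mxE row_mul rowK enum_rankK.
have fC C : C \in ch -> exists j, C = chamber_at j /\ (C \in A)%:R = mu + g 0 j.
  move=> CC; exists (enum_rank_in CC C); have eC : chamber_at (enum_rank_in CC C) = C.
    by rewrite /chamber_at enum_rankK_in.
  by split => //; rewrite !mxE eC mulr1 addrCA subrr addr0.
have kq (i : nat) : (i <= d)%N -> s^-1 * (k%:R / q%:R ^+ (d - i)) = q%:R ^+ n / q%:R ^+ (d - i).
  by move=> id; rewrite /s invf_div mulrA divfK.
(* The row of [x = 0] is constant and is multiplied by [k]; the second summand makes one formula
   cover this case too. *)
pose kap (i : 'I_d) (x : V) : K := k%:R / q%:R ^+ (d - i) + k%:R * (x == 0)%:R.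
have ptO (i : 'I_d) x j : (point_row K i x *m opp_mx F d K) 0 j =
    kap i x - k%:R / q%:R ^+ (d - i) * (x \in step (chamber_at j) (d - i))%:R.
  rewrite /kap; case: (eqVneq x 0) => [->|x0].
    by rewrite point_row0 (ones_opp K degk) mxE onesE mem0v !mulr1 addrAC subrr add0r.
  by rewrite (point_row_opp K degk) ?(ltnW (ltn_ord i)) // !mxE mulr0 addr0 mulrBr mulr1.
(* Dimension 0, and dimension [d] after the exchange, are the same for all chambers, so their terms
   go into the constants. *)
pose c0 := \sum_(i < d | ~~ (0 < i)%N) \sum_x co i x * (x == 0)%:R.
pose c1 := \sum_(i < d | ~~ (0 < i)%N) \sum_x co i x * (q%:R ^+ n / q%:R ^+ (d - i)).
pose c2 := \sum_(i < d) \sum_x co i x * (s^-1 * kap i x).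
exists phi, (mu + c0), (mu + (c1 - c2)) => C CC.
have [j [eC fj]] := fC C CC; rewrite fj; split; rewrite -addrA; congr (_ + _).
  have := expand 1%:M j; rewrite mulmx1 => ->.
  rewrite (bigID (fun i : 'I_d => (0 < i)%N)) /= addrC; congr (_ + _).
    apply: eq_bigr => i i0; apply: eq_bigr => x _; rewrite mulmx1 mxE.
    by rewrite (_ : nat_of_ord i = 0%N) ?memv0 //; lia.
  apply: eq_bigr => i i0; rewrite [RHS]big_mkcond; apply: eq_bigr => x _.
  by rewrite mulmx1 mxE -eC phiE; case: (_ \in _); rewrite ?mulr1 ?mulr0.
have gE : g 0 j = - s^-1 * (g *m opp_mx F d K) 0 j.
  have := congr1 (fun v : 'rV_m => v 0 j) gs; rewrite gT [RHS]mxE => ->.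
  by rewrite mulrA mulrNN mulVf ?mul1r // gt_eqF.
rewrite gE expand addrAC.
have -> : - s^-1 * (\sum_i \sum_x co i x * (point_row K i x *m opp_mx F d K) 0 j) =
  (\sum_i \sum_x co i x * (q%:R ^+ n / q%:R ^+ (d - i) * (x \in step C (d - i))%:R)) - c2.
  rewrite /c2 mulr_sumr -sumrB; apply: eq_bigr => i _.
  rewrite mulr_sumr -sumrB; apply: eq_bigr => x _.
  rewrite ptO -eC -kq ?(ltnW (ltn_ord i)) //; ring.
congr (_ - _).
rewrite (bigID (fun i : 'I_d => (0 < i)%N)) /= addrC; congr (_ + _).
  apply: eq_bigr => i i0; apply: eq_bigr => x _.
  rewrite (_ : nat_of_ord i = 0%N) ?subn0 ?stepd ?memvf ?mulr1 //; lia.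
pose psi (i : nat) x := q%:R ^+ n / q%:R ^+ (d - i) * phi i x.
have -> : flag_sum (fun j0 x => q%:R ^+ n / q%:R ^+ j0 * phi (d - j0)%N x) C =
   flag_sum (fun j0 => psi (d - j0)%N) C.
  apply: eq_bigr => i i0; apply: eq_bigr => x _.
  by rewrite /psi subKn // ltnW.
rewrite (flag_sum_rev psi); apply: eq_bigr => i i0; rewrite [RHS]big_mkcond; apply: eq_bigr => x _.
by rewrite /psi phiE; case: (_ \in _); rewrite ?mulr1 ?mulr0 // mulrC.
Qed.

End EKRStructure.

(** * Maximum sets *)

Section Incidence.
Local Open Scope ring_scope.
Variables (F : finFieldType) (d : nat).
Notation V := 'rV[F]_d.
Notation tup := (subspace_tuple F d).
Notation ch := (chambers F d).
Notation q := #|F|.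
Notation m := #|ch|.
Implicit Types (C D : tup) (U W : {vspace V}).

Let q1 : (1 < q)%N. Proof. exact: finRing_gt1. Qed.

(** Pairs of a vector of [W] and a chamber having it in dimension [i] are counted by vectors, with
    the zero vector apart. For [i = 1] and [i = d - 1] the exponent takes at most two values, so the
    sum determines how many chambers satisfy an inclusion. *)
Lemma sum_step_count W i : (i <= d)%N ->
  ((\sum_(D in ch) q ^ \dim (W :&: step D i)) * (q ^ d - 1) =
    m * (q ^ d - 1) + (q ^ \dim W - 1) * (m * (q ^ i - 1)))%N.
Proof.
move=> id; have [C0 CC] := chamber_exists F d.
have -> : (\sum_(D in ch) q ^ \dim (W :&: step D i) =
    \sum_(x in W) step_count i x)%N.
  rewrite /step_count exchange_big /=; apply: eq_bigr => D _.
  rewrite -card_vspace -sum1_card big_mkcond [RHS]big_mkcond /=.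
  by apply: eq_bigr => x _; rewrite memv_cap; case: (_ \in W) => //=; case: (_ \in _).
rewrite (bigD1 0) ?mem0v //= mulnDl; congr addn.
  congr muln; rewrite /step_count -sum1_card; apply: eq_bigr => D _; by rewrite mem0v.
rewrite big_distrl /= (eq_bigr (fun=> m * (q ^ i - 1))%N); last first.
  by move=> x /andP[_ x0]; rewrite (@step_countE F d i x C0).
rewrite sum_nat_const; congr muln.
rewrite -(card_vspace W) [in RHS](cardD1 0) mem0v add1n subn1 /=.
by apply: eq_card => x; rewrite !inE andbC.
Qed.

Lemma card_set_in (P : pred tup) :
  #|[set C in ch | P C]| = (\sum_(C in ch) P C)%N.
Proof.
rewrite -sum1_card (eq_bigl (fun C => (C \in ch) && P C)) => [|C]; last by rewrite inE.
by rewrite big_mkcondr; apply: eq_bigr => C _; case: (P C).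
Qed.

Lemma card_step1_in W : (0 < d)%N ->
  (#|[set C in ch | (step C 1 <= W)%VS]| * (q ^ d - 1) = m * (q ^ \dim W - 1))%N.
Proof.
move=> d0; have := sum_step_count W d0.
have -> : (\sum_(D in ch) q ^ \dim (W :&: step D 1) =
   #|[set C in ch | (step C 1 <= W)%VS]| * (q - 1) + m)%N.
  rewrite card_set_in big_distrl /= -(sum1_card (mem ch)) -big_split /=.
  apply: eq_bigr => C CC; case: (boolP (step C 1 <= W)%VS) => sW.
    by rewrite (capv_idPr sW) dim_step // expn1 mul1n subnK // ltnW.
  rewrite mul0n add0n.
  have le1 := dimvS (capvSr W (step C 1)); rewrite (dim_step CC d0) in le1.
  have ne1 : \dim (W :&: step C 1) != 1%N.
    apply: contra sW => /eqP e; apply/capv_idPr/eqP.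
    by rewrite eqEdim capvSr e dim_step.
  by move: le1 ne1; case: (\dim _) => [|[|]].
rewrite mulnDl addnC => /addnI; rewrite expn1 => e.
have q10 : (0 < q - 1)%N by lia.
by apply/eqP; rewrite -(eqn_pmul2r q10) mulnAC e [in X in _ == X]mulnAC mulnC.
Qed.

Lemma card_in_stepd1 W : (0 < \dim W)%N ->
  (#|[set C in ch | (W <= step C (d - 1))%VS]| * (q ^ d - 1)
    = m * (q ^ (d - \dim W) - 1))%N.
Proof.
move=> W0; have Wd : (\dim W <= d)%N.
  by have := dimvS (subvf W); rewrite dimvf /dim /= mul1n.
have := sum_step_count W (leq_subr 1 d).
set N := #|[set C in _ | _]|; set s := \dim W in W0 Wd *.
have -> : (\sum_(D in ch) q ^ \dim (W :&: step D (d - 1)) =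
   N * (q ^ s - q ^ s.-1) + m * q ^ s.-1)%N.
  rewrite /N card_set_in big_distrl /= -(sum1_card (mem ch)).
  rewrite big_distrl -big_split /=; apply: eq_bigr => C CC.
  case: (boolP (W <= step C (d - 1))%VS) => sW.
    by rewrite (capv_idPl sW) !mul1n subnK // leq_exp2l // leq_pred.
  rewrite mul0n add0n mul1n; congr expn.
  have lt_s : (\dim (W :&: step C (d - 1)) < s)%N.
    rewrite ltn_neqAle dimvS ?capvSl // andbT; apply: contra sW => /eqP e.
    by apply/capv_idPl/eqP; rewrite eqEdim capvSl e leqnn.
  have := dimv_sum_cap W (step C (d - 1)); rewrite dim_step ?leq_subr // -/s.
  have := dimvS (subvf (W + step C (d - 1))%VS); rewrite dimvf /dim /= mul1n.
  lia.
have [t st] : exists t, s = t.+1 by exists s.-1; lia.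
have [r dr] : exists r, d = (r + t.+1)%N by exists (d - s)%N; lia.
rewrite st /= (_ : d - t.+1 = r)%N; last by lia.
rewrite (_ : d - 1 = r + t)%N; last by lia.
rewrite dr !expnD !expnS.
have a0 : (0 < q ^ r)%N by rewrite expn_gt0; lia.
have b0 : (0 < q ^ t)%N by rewrite expn_gt0; lia.
move: (q ^ r)%N (q ^ t)%N a0 b0 => a b a0 b0.
have [p qp] : exists p, q = p.+2 by exists (q - 2)%N; lia.
rewrite qp => e.
have ab : (0 < a * (p.+2 * b) - 1)%N by nia.
have pb : (0 < p.+1 * b)%N by rewrite muln_gt0.
apply/eqP; rewrite -(eqn_pmul2r pb); apply/eqP.
have [x ax] : exists x, a = x.+1 by exists a.-1; lia.
have [y yb] : exists y, b = y.+1 by exists b.-1; lia.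
subst a b.
move: e ab.
have -> : (x.+1 * (p.+2 * y.+1) - 1 = x * (p.+2 * y.+1) + p.+1 * y.+1 + y)%N.
  by rewrite (_ : x.+1 * _ = (x * (p.+2 * y.+1) + p.+1 * y.+1 + y) + 1)%N ?addnK //; lia.
have -> : (p.+2 * y.+1 - y.+1 = p.+1 * y.+1)%N.
  by rewrite (_ : p.+2 * _ = p.+1 * y.+1 + y.+1)%N ?addnK //; lia.
have -> : (p.+2 * y.+1 - 1 = p.+1 * y.+1 + y)%N.
  by rewrite (_ : p.+2 * _ = (p.+1 * y.+1 + y) + 1)%N ?addnK //; lia.
have -> : (x.+1 * y.+1 - 1 = x * y.+1 + y)%N.
  by rewrite (_ : x.+1 * _ = (x * y.+1 + y) + 1)%N ?addnK //; lia.
rewrite subn1 /= => e _; lia.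
Qed.

Lemma hyperplane_exists W x : x \notin W ->
  exists H : {vspace V}, \dim H = (d - 1)%N /\ (W <= H)%VS.
Proof.
case/functional_exists => l lW lx.
exists (lker (linfun (mulmxr l) : 'Hom('rV[F]_d, 'rV[F]_1))); split; last first.
  by apply/subvP => w wW; rewrite memv_ker lfunE /= lW.
have := limg_ker_dim (linfun (mulmxr l) : 'Hom('rV[F]_d, 'rV[F]_1)) fullv.
rewrite capfv dimvf /dim /= mul1n.
have -> : limg (linfun (mulmxr l) : 'Hom('rV[F]_d, 'rV[F]_1)) = fullv.
  apply/vspaceP => a; rewrite memvf; apply/memv_imgP; exists (a 0 0 *: x).
    by rewrite memvf.
  by rewrite lfunE /= -scalemxAl lx [LHS]mx11_scalar scalemx1.
by rewrite dimvf /dim /= mul1n; move: (\dim _) => a; lia.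
Qed.

End Incidence.

(** * Maximum EKR-sets are of classical type *)

Section Maximum.
Local Open Scope ring_scope.
Variables (F : finFieldType) (n : nat).
Notation d := (2 * n)%N.
Notation V := 'rV[F]_d.
Notation tup := (subspace_tuple F d).
Notation ch := (chambers F d).
Notation q := #|F|.
Notation m := #|ch|.
Implicit Types (C D : tup) (U W : {vspace V}).
Hypothesis n_gt1 : (1 < n)%N.
Hypothesis q_big : (64 * d.-1 * d.-1 + 4 * d.-1 < q)%N.

Let q1 : (1 < q)%N. Proof. exact: finRing_gt1. Qed.

Let exp_sub1 : (q ^ d - 1 = (q ^ n + 1) * (q ^ n - 1))%N.
Proof.
rewrite [d]mulnC expnM -mulnn; case: (q ^ n)%N => [|a] //.
by rewrite (_ : a.+1 * a.+1 = ((a.+1 + 1) * a).+1)%N ?subn1 //; lia.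
Qed.

Lemma in_ch_set (P : pred tup) C : (C \in [set C in ch | P C]) = (C \in ch) && P C.
Proof. by rewrite in_set. Qed.

Lemma EKR_point x : x != 0 -> EKR_set [set C in ch | x \in step C n].
Proof.
move=> x0; split; first by apply/subsetP => C; rewrite in_ch_set => /andP[].
move=> C D; rewrite !in_ch_set => /andP[_ xC] /andP[_ xD] /oppP CD.
case/eqP: x0; apply: (opp_mem CD _ xC); first by lia.
by rewrite (_ : (d - n)%N = n) //; lia.
Qed.

Lemma EKR_hyperplane H : \dim H = (d - 1)%N -> EKR_set [set C in ch | (step C n <= H)%VS].
Proof.
move=> dH; split; first by apply/subsetP => C; rewrite in_ch_set => /andP[].
move=> C D; rewrite !in_ch_set => /andP[CC CH] /andP[DC DH] /oppP CD.
have nd : (n <= d)%N by lia.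
have := opp_full CC DC CD nd; rewrite (_ : (d - n)%N = n); last by lia.
move=> e; have : (fullv <= H)%VS by rewrite -e subv_add CH.
by move/dimvS; rewrite dH dimvf /dim /= mul1n; lia.
Qed.

Variable A : {set tup}.
Hypothesis A_max : maximum_EKR_set A.

Let A_ch : A \subset ch. Proof. by have [[]] := A_max. Qed.

Let A_le (B : {set tup}) : EKR_set B -> (#|B| <= #|A|)%N. Proof. by have [_] := A_max; apply. Qed.

Let A_eq (B : {set tup}) : EKR_set B -> A \subset B -> A = B.
Proof. by move=> eB sB; apply/eqP; rewrite eqEcard sB A_le. Qed.

Let A_opp : {in A &, forall C D, ~~ opp C D}.
Proof.
by move=> C D CA DA; apply/negP => /oppP; have [[_ H] _] := A_max; apply: H.
Qed.

(** The chambers with a given point in [C_n] form an EKR-set of exactly [m / (q^n + 1)] members,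
    which is the value of the ratio bound for the eigenvalue [- k / q^n]. *)
Lemma maximum_card : (m <= #|A| * (q ^ n + 1))%N.
Proof.
have [C CC] := chamber_exists F d.
have d0 : (0 < d)%N by lia.
have [x _ x0] := step_new CC d0; rewrite step0 memv0 in x0.
have nd : (n <= d)%N by lia.
have := step_countE CC nd x0.
have -> : step_count n x = #|[set C in ch | x \in step C n]| by rewrite card_set_in.
have qn : (0 < q ^ n - 1)%N by rewrite subn_gt0 -{1}(expn0 q) ltn_exp2l; lia.
rewrite exp_sub1 mulnA => /eqP; rewrite eqn_pmul2r // => /eqP <-.
by rewrite leq_mul2r A_le ?orbT //; apply: EKR_point.
Qed.

Lemma member_step C : member C n = step C n.
Proof. by rewrite step_member //; lia. Qed.

Lemma classical_point x j : x != 0 -> (j <= n)%N ->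
  (forall C, C \in A -> x \in step C j) -> classical_type A.
Proof.
move=> x0 jn H; left; exists <[x]>%VS; split; first by rewrite dim_vline x0.
have -> : [set C in ch | (<[x]> <= member C n)%VS] = [set C in ch | x \in step C n].
  by apply/setP => C; rewrite !in_ch_set member_step -memvE.
apply: A_eq; first exact: EKR_point.
apply/subsetP => C CA; have CC := subsetP A_ch C CA.
by rewrite in_ch_set CC (subvP (step_sub CC jn)) ?H.
Qed.

Lemma classical_hyperplane H j : \dim H = (d - 1)%N -> (n <= j)%N ->
  (forall C, C \in A -> (step C j <= H)%VS) -> classical_type A.
Proof.
move=> dH jn HA; right; exists H; split => //.
have -> : [set C in ch | (member C n <= H)%VS] = [set C in ch | (step C n <= H)%VS].
  by apply/setP => C; rewrite !in_ch_set member_step.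
apply: A_eq; first exact: EKR_hyperplane.
apply/subsetP => C CA; have CC := subsetP A_ch C CA.
by rewrite in_ch_set CC (subv_trans (step_sub CC jn)) ?HA.
Qed.

Let A_card : (m * (q ^ n - 1) <= #|A| * (q ^ d - 1))%N.
Proof.
by rewrite exp_sub1 mulnA leq_mul2r maximum_card orbT.
Qed.

Let A_pos : exists C, C \in A.
Proof.
have := maximum_card; have := card_ch_gt0 F d; case: (posnP #|A|) => [->|]; first by lia.
by move=> /card_gt0P[C CA]; exists C.
Qed.

(* Comparing [A] with [{C | C_1 <= W}] gives [dim W >= n], and comparing it with
   [{C | W <= C_(d-1)}] gives [dim W <= n]; hence [A = {C | C_1 <= W}], but moving
   [C_(d-1)] by a transvection that fixes [C_1] leaves this set. *)
Lemma no_separating_subspace W :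
  (forall C, C \in A -> (step C 1 <= W)%VS && (W <= step C (d - 1))%VS) -> False.
Proof.
move=> H; have d0 : (0 < d)%N by lia.
have [C CA] := A_pos; have CC := subsetP A_ch C CA.
have /andP[C1W WC] := H C CA.
have W0 : (0 < \dim W)%N.
  by have := dimvS C1W; rewrite dim_step.
have mpos := card_ch_gt0 F d.
have qd : (0 < q ^ d - 1)%N by rewrite subn_gt0 -{1}(expn0 q) ltn_exp2l; lia.
have qpos i : (0 < q ^ i)%N by rewrite expn_gt0; lia.
have sub1 : A \subset [set C in ch | (step C 1 <= W)%VS].
  by apply/subsetP => D DA; rewrite in_ch_set (subsetP A_ch D DA); case/andP: (H D DA).
have sub2 : A \subset [set C in ch | (W <= step C (d - 1))%VS].
  by apply/subsetP => D DA; rewrite in_ch_set (subsetP A_ch D DA); case/andP: (H D DA).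
have Wn : (n <= \dim W)%N.
  have := card_step1_in W d0; have := subset_leq_card sub1.
  rewrite -(leq_pmul2r qd) => /(leq_trans A_card) le1 e; rewrite e leq_pmul2l // in le1.
  rewrite -(leq_exp2l _ _ q1); have := qpos n; have := qpos (\dim W); lia.
have Wn2 : (\dim W <= n)%N.
  have := card_in_stepd1 W0; have := subset_leq_card sub2.
  rewrite -(leq_pmul2r qd) => /(leq_trans A_card) le1 e; rewrite e leq_pmul2l // in le1.
  have : (q ^ n <= q ^ (d - \dim W))%N.
    have := qpos n; have := qpos (d - \dim W)%N; lia.
  by rewrite leq_exp2l //; lia.
have dW : \dim W = n by apply/eqP; rewrite eqn_leq Wn Wn2.
have AE : A = [set C in ch | (step C 1 <= W)%VS].
  apply/eqP; rewrite eqEcard sub1 -(leq_pmul2r qd) card_step1_in // dW.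
  exact: A_card.
have [x xC x0] := step_new CC d0; rewrite step0 in x0.
have C1E := step_line CC d0 xC x0; rewrite step0 add0v in C1E.
have xW : x \in W by rewrite (subvP C1W).
have [z zW zx] : exists2 z, z \in W & z \notin <[x]>%VS.
  apply/subvPn/negP => /dimvS; rewrite dW dim_vline leqNgt.
  by rewrite (leq_ltn_trans (leq_b1 _) n_gt1).
have d1 : (d - 1 < d)%N by rewrite subn1 prednK.
have [y _ yC] := @step_new _ _ C (d - 1) CC d1.
have zN : z \notin (<[x]> + <[y]>)%VS.
  apply: contra zx => /memv_addP[_ /vlineP[a ->] [_ /vlineP[b ->] e]].
  have [b0|b0] := eqVneq b 0; first by rewrite e b0 scale0r addr0 memvZ // memv_line.
  case/negP: yC; have -> : y = b^-1 *: (z - a *: x).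
    by rewrite e addrAC subrr add0r scalerA mulVf // scale1r.
  by rewrite (subvP WC) // memvZ // memvB // memvZ.
(* The transvection fixes [x], hence [C_1], and maps [z - y] to [z]. As [z] is in [C_(d-1)] and [y]
   is not, [z - y] is outside [C_(d-1)], so the image of [C_(d-1)] misses the vector [z] of [W]. *)
have [l lxy lz] := functional_exists zN.
have yl : y *m l = 0 by apply: lxy; apply: (subvP (addvSr _ _)); rewrite memv_line.
have xl : x *m l = 0 by apply: lxy; apply: (subvP (addvSl _ _)); rewrite memv_line.
have gu := transvection_unit yl.
have gA : act (transvection l y) C \in A.
  rewrite AE in_ch_set act_chambers //= step_act //; apply/subvP => _ /memv_imgP[u uC ->].
  rewrite lfunE /= mul_transvection; move: uC; rewrite C1E => /vlineP[a ->].
  by rewrite -scalemxAl xl scaler0 mxE scale0r addr0 memvZ.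
have /andP[_ /subvP/(_ z zW)] := H _ gA.
have zg : (z - y) *m transvection l y = z.
  by rewrite mul_transvection mulmxBl yl subr0 lz mxE eqxx scale1r subrK.
rewrite -[z in z \in _]zg step_act // memv_actv // => zy.
case/negP: yC; rewrite -[y](subKr z) memvB // (subvP WC) //.
Qed.

Section NotClassical.
Hypothesis no_point : forall x, x != 0 -> exists2 C, C \in A & x \notin step C n.
Hypothesis no_hyperplane : forall H, \dim H = (d - 1)%N ->
  exists2 C, C \in A & ~~ (step C n <= H)%VS.

Let sum_step j := (\sum_(C in A) step C j)%VS.

Let le_sum_step j C : C \in A -> (step C j <= sum_step j)%VS.
Proof. by move=> CA; apply: sumv_sup (subvv _). Qed.

Lemma not_common j x : (j <= n)%N -> x != 0 -> exists2 C, C \in A & x \notin step C j.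
Proof.
move=> jn x0; have [C CA xC] := no_point x0; exists C => //.
by apply: contra xC; apply/subvP/step_sub; first exact: (subsetP A_ch).
Qed.

Lemma sum_step_full j x : (n <= j)%N -> x \in sum_step j.
Proof.
move=> nj; apply/negPn/negP => /hyperplane_exists[H [dH WH]].
have [C CA /negP[]] := no_hyperplane dH.
apply: subv_trans WH; apply: subv_trans (le_sum_step j CA).
by apply: step_sub => //; apply: (subsetP A_ch).
Qed.

(** The small subspaces [C_i] need not span, and a vector may lie in all the large ones [C_(d-i)].
    By [no_separating_subspace] some [s] is in the span of the small ones and outside a large one,
    and every [v] is compared with it: inside the span through the small family; outside it through
    the large family, after a shift to [v + s] if [v] lies in the large subspace that [s] avoids. *)
Lemma point_function_const (K : Type) (Phi : V -> K) i :
  (0 < i <= n)%N ->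
  (forall C v r, C \in A -> v \notin step C i -> r \in step C i -> Phi v = Phi (v + r)) ->
  (forall C v r, C \in A -> v \notin step C (d - i) -> r \in step C (d - i) ->
     Phi v = Phi (v + r)) ->
  forall v w, v != 0 -> w != 0 -> Phi v = Phi w.
Proof.
move=> /andP[i0 idn] PhiS PhiB.
have dimS C : C \in A -> \dim (step C i) = i.
  by move=> CA; rewrite dim_step //; [apply: (subsetP A_ch) | lia].
have dimB C : C \in A -> \dim (step C (d - i)) = (d - i)%N.
  by move=> CA; rewrite dim_step ?leq_subr //; apply: (subsetP A_ch).
have fullB u : u \in sum_step (d - i)%N by apply: sum_step_full; lia.
have [s [sS s0 [C CA sC]]] : exists s, [/\ s \in sum_step i, s != 0 &
    exists2 C, C \in A & s \notin step C (d - i)].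
  have [/existsP[s /andP[sS /existsP[C /andP[CA sC]]]]|] := boolP [exists s,
     (s \in sum_step i) && [exists C, (C \in A) && (s \notin step C (d - i))]].
    exists s; split => //; last by exists C.
    by apply: contraNneq sC => ->; rewrite mem0v.
  rewrite negb_exists => /forallP H; exfalso.
  apply: (@no_separating_subspace (sum_step i)) => C CA.
  have CC := subsetP A_ch C CA; apply/andP; split.
    exact: subv_trans (step_sub CC i0) (le_sum_step i CA).
  apply: subv_trans (step_sub CC (_ : d - i <= d - 1)%N); last by lia.
  apply/subvP => s sS; have := H s; rewrite sS /= negb_exists => /forallP/(_ C).
  by rewrite CA negbK.
suff H v : v != 0 -> Phi v = Phi s by move=> v w v0 w0; rewrite !H.
move=> v0; have sB : exists2 C, C \in A & s \notin step C (d - i) by exists C.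
case: (boolP (v \in sum_step i)) => vS.
  by apply: (family_const dimS PhiS) => //; apply: not_common.
rewrite (family_coset PhiS vS sS).
case: (boolP (v \in step C (d - i))) => vC.
  apply: (family_const dimB PhiB) => //; exists C => //.
  by apply: contra sC => h; rewrite -[s](addrK v) [s + v]addrC memvB.
rewrite -(family_coset PhiS vS sS).
by apply: (family_const dimB PhiB) => //; exists C.
Qed.

(** Constant line sums make [flag_sum phi] depend on dimensions only, so the characteristic function
    takes the same value at a member of [A] and at a chamber opposite to it. *)
Lemma not_classical_absurd : False.
Proof.
have dd : d = (2 * n)%N by [].
have [phi [c [c' H]]] := ekr_structure algC dd n_gt1 q_big A_ch A_opp maximum_card.
pose Phi i v := \sum_(a : F) phi i (a *: v).
have oppA C D : C \in A -> D \in ch -> opp C D -> (D \in A) = false.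
  by move=> CA DC CD; apply: contraTF CD => DA; apply: A_opp.
have PhiB i C v r : (0 < i < d)%N -> C \in A ->
    v \notin step C (d - i) -> r \in step C (d - i) -> Phi i v = Phi i (v + r).
  move=> id CA vN rS; have CC := subsetP A_ch C CA.
  apply: (shift_invariance (k := - c) CC id _ vN rS) => D DC CD.
  have [e _] := H D DC; move: e; rewrite (oppA C D CA DC CD) => /eqP.
  by rewrite eq_sym addrC addr_eq0 => /eqP.
have PhiS i C v r : (0 < i < d)%N -> C \in A ->
    v \notin step C i -> r \in step C i -> Phi i v = Phi i (v + r).
  move=> id CA vN rS; have CC := subsetP A_ch C CA.
  have id' : (0 < d - i < d)%N by lia.
  have ei : (d - (d - i))%N = i by rewrite subKn //; lia.
  have vN' : v \notin step C (d - (d - i)) by rewrite ei.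
  have rS' : r \in step C (d - (d - i)) by rewrite ei.
  have := shift_invariance (phi := fun j x => q%:R ^+ n / q%:R ^+ j * phi (d - j)%N x)
    (k := - c') CC id' _ vN' rS'.
  rewrite ei -!mulr_sumr => e; apply: (mulfI _ (e _)).
    by rewrite mulf_neq0 ?invr_eq0 ?expf_neq0 // pnatr_eq0; lia.
  move=> D DC CD; have [_ e'] := H D DC; move: e'; rewrite (oppA C D CA DC CD) => /eqP.
  by rewrite eq_sym addrC addr_eq0 => /eqP.
have Phi_const i v w : (0 < i < d)%N -> v != 0 -> w != 0 -> Phi i v = Phi i w.
  move=> id; have [le_in|lt_ni] := leqP i n.
    apply: (point_function_const (i := i)) => [|C u r CA|C u r CA]; first by lia.
      exact: PhiS.
    exact: PhiB.
  apply: (point_function_const (i := (d - i)%N)) => [|C u r CA|C u r CA]; first by lia.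
    exact: PhiB.
  rewrite subKn; last by lia.
  exact: PhiS.
have [C CA] := A_pos; have CC := subsetP A_ch C CA.
have [D DC CD] := opp_exists CC; have DN := oppA C D CA DC CD.
have q0 : (q.-1%:R : algC) != 0 by rewrite pnatr_eq0; lia.
(* Each nonzero scalar permutes [W], so the line sums over [W] recover [\sum_(x in W) phi i x] up to
   a multiple of [phi i 0]. *)
have sumW i (W : {vspace V}) : \sum_(x in W) Phi i x =
    (q ^ \dim W)%:R * phi i 0 + q.-1%:R * \sum_(x in W) phi i x.
  rewrite /Phi exchange_big /= (bigD1 0) //=; congr (_ + _).
    under eq_bigr do rewrite scale0r.
    by rewrite sumr_const card_vspace -[LHS]mulr_natl.
  rewrite (eq_bigr (fun=> \sum_(x in W) phi i x)) => [|a a0].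
    by rewrite sumr_const -[LHS]mulr_natl -(cardC1 (0 : F)); congr (_%:R * _); apply: eq_card.
  rewrite [RHS](reindex_inj (scalerI a0)) /=; apply: eq_bigl => x.
  apply/idP/idP => [xW|]; first by rewrite memvZ.
  by move=> axW; rewrite -[x]scale1r -(mulVf a0) -scalerA memvZ.
have Phi_sum i (U W : {vspace V}) : (0 < i < d)%N -> \dim U = \dim W ->
    \sum_(x in U) Phi i x = \sum_(x in W) Phi i x.
  move=> id dUW; rewrite (bigD1 0) ?mem0v // [RHS](bigD1 0) ?mem0v //=; congr (_ + _).
  have [y y0] : exists y : V, y != 0.
    have d0 : (0 < d)%N by lia.
    by have [y _] := step_new CC d0; rewrite step0 memv0; exists y.
  have cst (X : {vspace V}) : \sum_(x in X | x != 0) Phi i x = Phi i y *+ (q ^ \dim X).-1.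
    rewrite (eq_bigr (fun=> Phi i y)) => [|x /andP[_ x0]]; last exact: Phi_const.
    rewrite sumr_const; congr (_ *+ _); rewrite -card_vspace [in RHS](cardD1 0) mem0v add1n /=.
    by apply: eq_card => x; rewrite !inE andbC.
  by rewrite !cst dUW.
have totCD : flag_sum phi C = flag_sum phi D.
  apply: eq_bigr => i i0; have id : (0 < i < d)%N by rewrite i0 ltn_ord.
  have dCD : \dim (step C i) = \dim (step D i) by rewrite !dim_step // ltnW.
  have := Phi_sum i _ _ id dCD; rewrite !sumW dCD => /addrI.
  exact: mulfI.
have [eC _] := H C CC; have [eD _] := H D DC.
by have := eqxx (1 : algC); rewrite -{1}[1]/(true%:R) -CA eC totCD -eD DN eq_sym oner_eq0.
Qed.

End NotClassical.

Lemma maximum_EKR_classical : classical_type A.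
Proof.
have [/existsP[x /andP[x0 /forallP H]]|] := boolP [exists x : V, (x != 0) &&
    [forall C, (C \in A) ==> (x \in step C n)]].
  by apply: (classical_point x0 (leqnn n)) => C CA; have /implyP := H C; apply.
rewrite negb_exists => /forallP N1.
have [/existsP[W /andP[/eqP dW /forallP H]]|] := boolP [exists W : {vspace V},
    (\dim W == d - 1)%N && [forall C, (C \in A) ==> (step C n <= W)%VS]].
  by apply: (classical_hyperplane dW (leqnn n)) => C CA; have /implyP := H C; apply.
rewrite negb_exists => /forallP N2.
exfalso; apply: not_classical_absurd => [x x0|W dW].
  have := N1 x; rewrite x0 /= negb_forall => /existsP[C].
  by rewrite negb_imply => /andP[CA xC]; exists C.
have := N2 W; rewrite dW eqxx /= negb_forall => /existsP[C].
by rewrite negb_imply => /andP[CA xC]; exists C.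
Qed.

End Maximum.

(* Prime powers q are exactly the cardinalities #|F| of finite fields F. *)
Theorem theorem1p3 :
  forall n : nat, 3 <= n ->
  exists m : nat, forall F : finFieldType, m <= #|F| ->
  forall A : {set subspace_tuple F (2 * n)},
    maximum_EKR_set A -> classical_type A.
Proof.
(* The threshold is that of [gap_arith] with [D = 2n - 1]; the successor turns [<=] into the strict
   inequality there. *)
move=> n n3; exists (64 * (2 * n).-1 * (2 * n).-1 + 4 * (2 * n).-1).+1.
by move=> F q_big A A_max; apply: maximum_EKR_classical => //; lia.
Qed.
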